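(* Let $H^2(\mathbb{D})$ be the Hardy space of the unit disc. A linear map $\tilde R:H^2(\mathbb{D})\to H^2(\mathbb{D})$ is a bounded radial operator if and only if there exists a distribution $u\in\mathcal{D}'(\mathbb{T})$ with $(\hat u(m))_{m\in\mathbb{Z}_+}\in\ell^\infty(\mathbb{Z}_+)$ which induces an analytic function $g$ on $\mathbb{D}$ such that $$\tilde Rf(z)=\hat u(0)f(0)+z\int_{\mathbb{D}}f'(w)\,g'(z\bar w)\log\frac{1}{|w|^2}\,dA(w)\quad\text{for all } f\in H^2(\mathbb{D}),\ z\in\mathbb{D}.$$
   Context: $\mathbb{D}$ is the open unit disc, $dA$ the normalized area measure, $\mathbb{Z}_+=\{0,1,2,\dots\}$. $H^2(\mathbb{D})$ is the Hardy–Hilbert space, whose norm satisfies $\|f\|^2=|f(0)|^2+\int_{\mathbb{D}}|f'(z)|^2\log\frac{1}{|z|^2}\,dA(z)$; here $\|z^m\|=1$ for all $m\ge0$. For $\lambda\in\mathbb{T}$, $V_\lambda f(z)=f(\lambda z)$; a bounded $\tilde R$ is radial if $\tilde RV_\lambda=V_\lambda\tilde R$ for all $\lambda\in\mathbb{T}$. $\mathcal{D}'(\mathbb{T})$ is the space of periodic distributions with Fourier coefficients $\hat u(m)$. Induced functions are defined as for weighted Bergman spaces with the $H^2$ norm: for $0\le r<1$, $K_r$ is the distribution $\sum_{m\ge0}\|z^m\|^{-2}r^me^{im\theta}=\sum_{m\ge0}r^me^{im\theta}$, and $g$ is induced by $u$ if for every $r\in[0,1)$, $\theta\mapsto g(re^{i\theta})$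 is the sum of the Fourier series of $K_r*u$, i.e. $g(z)=\sum_{m\ge0}\hat u(m)z^m$. *)

(* Defs.v *)
From HB Require Import structures.
From mathcomp Require Import all_boot all_order all_algebra.
From mathcomp Require Import complex.
From mathcomp Require Import all_classical all_reals all_analysis.
Set Implicit Arguments. Unset Strict Implicit. Unset Printing Implicit Defensive.
Import Order.TTheory GRing.Theory Num.Theory.
Import numFieldNormedType.Exports.
Local Open Scope ring_scope.
Local Open Scope complex_scope.
Local Open Scope classical_set_scope.

Section Defs.
Variable R : realType.

Definition csqn (z : R[i]) : R := complex.Re z ^+ 2 + complex.Im z ^+ 2.
Definition cabs (z : R[i]) : R := Num.sqrt (csqn z).

Definition inD (z : R[i]) : bool := csqn z < 1.

Definition cderiv (g : R[i] -> R[i]) (z : R[i]) : R[i] :=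
  @derive1 R[i] R[i]^o g z.

Definition pseries_to (a : nat -> R[i]) (z l : R[i]) : Prop :=
  series (fun m => a m * z ^+ m : R[i]^o) n @[n --> \oo] --> (l : R[i]^o).

Definition sqsummable (a : nat -> R[i]) : Prop :=
  cvgn (series (fun m => csqn (a m))).
Definition l2norm (a : nat -> R[i]) : R :=
  Num.sqrt (limn (series (fun m => csqn (a m)))).

(* f is the element of H^2(D) with Taylor coefficients a.
   Convention: elements of H^2 are represented by functions C -> C that
   vanish outside D, so that equality in H^2 is Leibniz equality. *)
Definition H2coef (f : R[i] -> R[i]) (a : nat -> R[i]) : Prop :=
  sqsummable a /\
  (forall z, inD z -> pseries_to a z (f z)) /\
  (forall z, ~~ inD z -> f z = 0).

Definition H2 : set (R[i] -> R[i]) := [set f | exists a, H2coef f a].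

Definition H2_linear (T : (R[i] -> R[i]) -> (R[i] -> R[i])) : Prop :=
  (forall f, H2 f -> H2 (T f)) /\
  (forall (c : R[i]) f g, H2 f -> H2 g ->
     T (fun z => c * f z + g z) = (fun z => c * T f z + T g z)).

Definition H2_bounded (T : (R[i] -> R[i]) -> (R[i] -> R[i])) : Prop :=
  exists M : R, forall f a b, H2coef f a -> H2coef (T f) b ->
    l2norm b <= M * l2norm a.

Definition Vrot (lam : R[i]) (f : R[i] -> R[i]) : R[i] -> R[i] :=
  fun z => f (lam * z).

Definition H2_radial (T : (R[i] -> R[i]) -> (R[i] -> R[i])) : Prop :=
  forall lam : R[i], csqn lam = 1 ->
    forall f, H2 f -> T (Vrot lam f) = Vrot lam (T f).

Definition smooth_periodic (phi : R -> R) : Prop :=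
  (forall (k : nat) (x : R), derivable (derive1n k phi) x 1) /\
  (forall x : R, phi (x + 2 * pi) = phi x).

(* periodic distributions u in D'(T): (complex-valued) continuous linear
   functionals on C^oo(T); a complex-valued distribution is determined by
   its R-linear action on real test functions (complexification). *)
Definition periodic_distribution (u : (R -> R) -> R[i]) : Prop :=
  (forall (a b : R) (phi psi : R -> R),
     smooth_periodic phi -> smooth_periodic psi ->
     u (fun t => a * phi t + b * psi t) = a%:C * u phi + b%:C * u psi) /\
  (exists (K : R) (N : nat), forall phi, smooth_periodic phi ->
     forall B : R, (forall (k : nat) (x : R), (k <= N)%N ->
                      `|derive1n k phi x| <= B) ->
     cabs (u phi) <= K * B).

(* Fourier coefficients  u^(m) = < u , e^{-i m t} >
   ( = (1/2pi) int u(t) e^{-imt} dt when u is a function ) *)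
Definition fourier_coef (u : (R -> R) -> R[i]) (m : nat) : R[i] :=
  u (fun t => cos (m%:R * t)) - 'i * u (fun t => sin (m%:R * t)).

(* u induces g: for r in [0,1), g(r e^{it}) is the sum of the Fourier
   series of K_r * u, i.e. g(z) = sum_{m>=0} u^(m) z^m on D *)
Definition induces (u : (R -> R) -> R[i]) (g : R[i] -> R[i]) : Prop :=
  forall z, inD z -> pseries_to (fourier_coef u) z (g z).

Definition disc_set : set (R * R) := [set p | p.1 ^+ 2 + p.2 ^+ 2 < 1].

Definition disc_integral (F : R[i] -> R[i]) : R[i] :=
  (pi^-1 * Rintegral ((@lebesgue_measure R) \x (@lebesgue_measure R))%E
              disc_set (fun p => complex.Re (F (p.1 +i* p.2))))%:C
  + 'i * (pi^-1 * Rintegral ((@lebesgue_measure R) \x (@lebesgue_measure R))%E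
              disc_set (fun p => complex.Im (F (p.1 +i* p.2))))%:C.

Definition logw (w : R[i]) : R := ln ((csqn w)^-1).

End Defs.

(* Main.v *)
Require Import Defs.
From HB Require Import structures.
From mathcomp Require Import all_boot all_order all_algebra.
From mathcomp Require Import complex.
From mathcomp Require Import all_classical all_reals all_analysis.
From mathcomp Require Import measurable_realfun ring lra.
Set Implicit Arguments.
Unset Strict Implicit.
Unset Printing Implicit Defensive.
Import Order.TTheory GRing.Theory Num.Theory.
Import numFieldNormedType.Exports.
Local Open Scope ring_scope.
Local Open Scope complex_scope.
Local Open Scope classical_set_scope.

(** A bounded radial operator acts on Taylor coefficients by a bounded multiplier [c]:
    commuting with the rotation by a [lam] such that [lam ^ |k - m| = -1] kills the [k]-th
    coefficient of the image of [z ^ m] when [k <> m], and boundedness passes from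
    polynomials to all of H^2. Conversely every bounded multiplier is bounded and radial.
    A bounded sequence [c] is the sequence of nonnegative Fourier coefficients of a periodic
    distribution, because the Fourier coefficients of a test function decay like [1 / n ^ 2].

    It remains to see that the integral formula is the multiplier with symbol [c], that is,
    that [w ^ j * conj w ^ k * log (1 / |w| ^ 2)] has integral [1 / (j + 1) ^ 2] if [j = k]
    and [0] otherwise with respect to [dA], and that the double series may be integrated
    termwise. In place of polar coordinates we use that [d_x G] and [d_y G] have integral
    zero whenever [G] vanishes on the unit circle. Let [h] be [w ^ j * conj w ^ k] times the
    smooth weight [L_e = log ((1 + e) / (|w| ^ 2 + e))]. The divergence of [h * (- y, x)] is
    [i (j - k) h], so the integral vanishes for [j <> k]. For [j = k] the divergence of
    [h * (x, y)] yields [(j + 1) int |w| ^ 2j L_e = int |w| ^ (2j + 2) / (|w| ^ 2 + e)], and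
    [e] tends to [0]. Termwise integration is dominated convergence: the integral of
    [m |a_m| |w| ^ (m - 1) log (1 / |w| ^ 2)] is [O (|a_m| / m)], which is summable because
    [a] is square summable. *)

(** * The modulus of R[i] and complex limits *)

Section ComplexModulus.
Variable R : realType.
Local Notation C := R[i].
Implicit Types z w : C.

(** The norm of [R[i]] is itself [R[i]]-valued; together with the injectivity [complexI] this
    equation transfers its properties to the real-valued [cabs]. *)
Lemma normcE z : `|z| = (cabs z)%:C.
Proof. by rewrite normc_def. Qed.

Lemma cabs_ge0 z : 0 <= cabs z.
Proof. exact: sqrtr_ge0. Qed.

Lemma cabsM z w : cabs (z * w) = cabs z * cabs w.
Proof. by apply: complexI; rewrite rmorphM /= -!normcE normrM. Qed.

Lemma cabs0 : cabs (0 : C) = 0.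
Proof. by apply: complexI; rewrite -normcE normr0. Qed.

Lemma cabs1 : cabs (1 : C) = 1.
Proof. by apply: complexI; rewrite -normcE normr1. Qed.

Lemma cabsX z n : cabs (z ^+ n) = cabs z ^+ n.
Proof. by elim: n => [|n IH]; rewrite ?expr0 ?cabs1// !exprS cabsM IH. Qed.

Lemma cabsN z : cabs (- z) = cabs z.
Proof. by apply: complexI; rewrite -!normcE normrN. Qed.

Lemma cabsB z w : cabs (z - w) = cabs (w - z).
Proof. by rewrite -cabsN opprB. Qed.

Lemma cabsD z w : cabs (z + w) <= cabs z + cabs w.
Proof. by rewrite -lecR rmorphD /= -!normcE ler_normD. Qed.

Lemma cabs_eq0 z : (cabs z == 0) = (z == 0).
Proof. by rewrite -(inj_eq (@complexI R)) -normcE normr_eq0. Qed.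

Lemma cabs_real (x : R) : cabs x%:C = `|x|.
Proof. by rewrite /cabs /csqn /= expr0n addr0 sqrtr_sqr. Qed.

Lemma cabs_nat n : cabs (n%:R : C) = n%:R.
Proof. by rewrite -(rmorph_nat (real_complex R)) cabs_real normr_nat. Qed.

Lemma cabs_conj z : cabs (conjc z) = cabs z.
Proof. by case: z => x y; rewrite /cabs /csqn /= sqrrN. Qed.

Lemma csqn_ge0 z : 0 <= csqn z.
Proof. by rewrite addr_ge0 ?sqr_ge0. Qed.

Lemma csqnE z : csqn z = cabs z ^+ 2.
Proof. by rewrite sqr_sqrtr ?csqn_ge0. Qed.

Lemma inDE z : inD z = (cabs z < 1).
Proof. by rewrite /inD csqnE expr_lt1 ?cabs_ge0. Qed.

Lemma Re_le_cabs z : `|complex.Re z| <= cabs z.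
Proof. by rewrite -sqrtr_sqr ler_wsqrtr// lerDl sqr_ge0. Qed.

Lemma Im_le_cabs z : `|complex.Im z| <= cabs z.
Proof. by rewrite -sqrtr_sqr ler_wsqrtr// lerDr sqr_ge0. Qed.

Lemma cabs_le_ReIm z : cabs z <= `|complex.Re z| + `|complex.Im z|.
Proof.
rewrite -(@ler_pXn2r _ 2) ?nnegrE ?cabs_ge0 ?addr_ge0//.
rewrite -csqnE /csqn sqrrD !real_normK ?num_real//.
by rewrite addrAC lerDl mulrn_wge0 ?mulr_ge0.
Qed.

Lemma ler_cabs_sum (I : Type) (r : seq I) (P : pred I) (f : I -> C) :
  cabs (\sum_(i <- r | P i) f i) <= \sum_(i <- r | P i) cabs (f i).
Proof.
elim/big_rec2: _ => [|i x y _ h]; first by rewrite cabs0.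
by rewrite (le_trans (cabsD _ _))// lerD2l.
Qed.

Lemma ler_cabs_dist z w : `|cabs z - cabs w| <= cabs (z - w).
Proof.
have h1 := cabsD (z - w) w; have h2 := cabsD (w - z) z.
rewrite !subrK (cabsB w z) in h1 h2.
by rewrite ler_norml; apply/andP; split; lra.
Qed.

Lemma cvgCdistP (T : Type) (F : set_system T) {FF : Filter F} (f : T -> C) (l : C) :
  f @ F --> (l : C^o) <-> forall e : C, 0 < e -> \forall x \near F, `|l - f x| < e.
Proof. exact: (@cvgrPdist_lt C C^o). Qed.

(** Complex limits quantify over complex radii. Reducing them to real limits of moduli gives access
    to squeezing and to the order on [R]. *)
Lemma ccvgP (T : Type) (F : set_system T) {FF : Filter F} (f : T -> C) (l : C) :
  f @ F --> (l : C^o) <-> cabs (f x - l) @[x --> F] --> (0 : R).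
Proof.
split=> [/cvgCdistP H|/cvgrPdist_lt H]; [apply/cvgrPdist_lt|apply/cvgCdistP] => e e0.
  have e0' : 0 < e%:C by rewrite ltcR.
  apply: filterS (H _ e0') => x.
  by rewrite normcE ltcR sub0r normrN ger0_norm ?cabs_ge0// cabsB.
(* A positive element of [R[i]] has zero imaginary part, so its real part is the radius. *)
move: e0; rewrite ltcE => /andP[/eqP ei er].
apply: filterS (H _ er) => x; rewrite sub0r normrN ger0_norm ?cabs_ge0//.
by rewrite normcE ltcE /= cabsB ei eqxx.
Qed.

Lemma ccvg_le (T : Type) (F : set_system T) {FF : Filter F} (f : T -> C) (l : C)
    (g : T -> R) :
  (\forall x \near F, cabs (f x - l) <= g x) -> g x @[x --> F] --> (0 : R) ->
  f @ F --> (l : C^o).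
Proof.
move=> fg g0; apply/ccvgP; apply: (squeeze_cvgr _ (cvg_cst 0) g0).
by apply: filterS fg => x ->; rewrite cabs_ge0.
Qed.


Lemma ccvg_ReIm (T : Type) (F : set_system T) {FF : Filter F} (f : T -> C) (l : C) :
  f @ F --> (l : C^o) <->
  complex.Re (f x) @[x --> F] --> complex.Re l /\
  complex.Im (f x) @[x --> F] --> complex.Im l.
Proof.
split=> [/ccvgP /cvgrPdist_lt H|[/cvgrPdist_lt H1 /cvgrPdist_lt H2]].
  split; apply/cvgrPdist_lt => e e0; apply: filterS (H e e0) => x;
    rewrite sub0r normrN ger0_norm ?cabs_ge0// cabsB; apply: le_lt_trans.
    by rewrite (le_trans _ (Re_le_cabs _))// raddfB.
  by rewrite (le_trans _ (Im_le_cabs _))// raddfB.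
apply/ccvgP/cvgrPdist_lt => e e0; have e2 : 0 < e / 2 by rewrite divr_gt0.
apply: filterS2 (H1 _ e2) (H2 _ e2) => x h1 h2.
rewrite sub0r normrN ger0_norm ?cabs_ge0// cabsB.
rewrite (le_lt_trans (cabs_le_ReIm _))// !raddfB /=.
by rewrite (splitr e) ltrD.
Qed.

(** A total function built from the two real limits. It is the sum of the series as soon as the
    moduli have a summable majorant, by [cvg_csum]. *)
Definition csum (a : nat -> C) : C :=
  limn (series (fun n => complex.Re (a n))) +i*
  limn (series (fun n => complex.Im (a n))).

Lemma Re_series (a : nat -> C) n :
  complex.Re (series (a : nat -> C^o) n) = series (fun n => complex.Re (a n)) n.
Proof. by rewrite /series /= raddf_sum. Qed.

Lemma Im_series (a : nat -> C) n :
  complex.Im (series (a : nat -> C^o) n) = series (fun n => complex.Im (a n)) n.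
Proof. by rewrite /series /= raddf_sum. Qed.

Lemma cvg_csum (a : nat -> C) (b : nat -> R) :
  (forall n, cabs (a n) <= b n) -> cvgn (series b) ->
  series (a : nat -> C^o) @ \oo --> (csum a : C^o).
Proof.
move=> ab cb; have b0 n : 0 <= b n := le_trans (cabs_ge0 _) (ab n).
apply/ccvg_ReIm; split.
  under eq_fun do rewrite Re_series.
  apply: normed_cvg; apply: (series_le_cvg _ b0 _ cb) => n /=; first exact: normr_ge0.
  exact: le_trans (Re_le_cabs _) (ab n).
under eq_fun do rewrite Im_series.
apply: normed_cvg; apply: (series_le_cvg _ b0 _ cb) => n /=; first exact: normr_ge0.
exact: le_trans (Im_le_cabs _) (ab n).
Qed.

Lemma cvg_cabs (T : Type) (F : set_system T) {FF : Filter F} (f : T -> C) (l : C) :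
  f @ F --> (l : C^o) -> cabs (f x) @[x --> F] --> cabs l.
Proof.
move=> /ccvgP/cvgrPdist_lt H; apply/cvgrPdist_lt => e e0.
apply: filterS (H e e0) => x; rewrite sub0r normrN ger0_norm ?cabs_ge0// cabsB.
exact/le_lt_trans/ler_cabs_dist.
Qed.

Lemma cvg_series_le (a : nat -> C) (l : C) (b : nat -> R) :
  series (a : nat -> C^o) @ \oo --> (l : C^o) ->
  (forall n, cabs (a n) <= b n) -> cvgn (series b) ->
  cabs l <= limn (series b).
Proof.
move=> al ab cb; have cl : cabs (series (a : nat -> C^o) n) @[n --> \oo] --> cabs l.
  exact: cvg_cabs.
rewrite -(cvg_lim _ cl)//; apply: ler_lim => //; first by apply/cvg_ex; exists (cabs l).
apply: nearW => n; rewrite (le_trans (ler_cabs_sum _ _ _))//.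
exact: ler_sum.
Qed.

Lemma cvgC_unique (f : nat -> C) (l l' : C) :
  f @ \oo --> (l : C^o) -> f @ \oo --> (l' : C^o) -> l = l'.
Proof.
move=> /ccvg_ReIm[r1 i1] /ccvg_ReIm[r2 i2].
have hr := cvg_unique (@Rhausdorff R) r1 r2; have hi := cvg_unique (@Rhausdorff R) i1 i2.
by apply/eqP; rewrite eq_complex hr hi !eqxx.
Qed.

End ComplexModulus.

(** * Green's theorem on the disc *)

Section Green.
Variable R : realType.
Local Notation C := R[i].
Local Notation leb := (@lebesgue_measure R).
Local Notation mu := (leb \x leb)%E.
(* [lebesgue_measure] lives on [measurableTypeR R], whose display does not unify
   with the one of the canonical measurable structure on [R]. *)
Local Notation RR := (measurableTypeR R * measurableTypeR R)%type.
Local Notation D := (@disc_set R : set RR).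

Lemma measurable_fstR : measurable_fun setT (fun p : RR => p.1 : R).
Proof. by move=> m Y mY; exact: measurable_fst. Qed.

Lemma measurable_sndR : measurable_fun setT (fun p : RR => p.2 : R).
Proof. by move=> m Y mY; exact: measurable_snd. Qed.

Lemma FTC_derive (F f : R -> R) (a b : R) : a < b ->
  (forall x : R, is_derive x 1 F (f x)) -> continuous f ->
  (\int[leb]_(x in `[a, b]) (f x)%:E = (F b - F a)%:E)%E.
Proof.
move=> ab dF cf; have cF x : {for x, continuous F}.
  by apply: differentiable_continuous; apply/derivable1_diffP; have [] := dF x.
rewrite (@continuous_FTC2 _ f F)//.
- exact: continuous_subspaceT.
- split=> [x _||]; first by have [] := dF x.
    by apply: cvg_at_right_filter; exact: cF.
  by apply: cvg_at_left_filter; exact: cF.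
- by move=> x _; rewrite derive1E; have [_ ->] := dF x.
Qed.

Lemma measurable_rho : measurable_fun setT (fun p : RR => p.1 ^+ 2 + p.2 ^+ 2).
Proof.
by apply: measurable_funD; apply: measurable_funX;
  [exact: measurable_fstR|exact: measurable_sndR].
Qed.

Lemma measurable_disc : measurable D.
Proof.
have -> : D = (fun p : RR => p.1 ^+ 2 + p.2 ^+ 2) @^-1` `]-oo, 1[%classic.
  by apply/seteqP; split => p; rewrite /disc_set /= in_itv.
by rewrite -[X in measurable X]setTI; exact: measurable_rho.
Qed.
Local Hint Resolve measurable_disc : core.

Lemma disc_finite : (mu D < +oo)%E.
Proof.
have m1 : measurable (`[-1, 1]%classic `*` `[-1, 1]%classic : set RR).
  exact: measurableX.
apply: (@le_lt_trans _ _ (mu (`[-1, 1]%classic `*` `[-1, 1]%classic))).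
  apply: le_measure; rewrite ?inE// => -[x y]; rewrite /disc_set/= => h.
  by rewrite !in_itv /=; split; apply/andP; split; nra.
rewrite product_measure1E//= lebesgue_measure_itv/= lte_fin.
by rewrite (_ : (-1 < 1 :> R) = true) ?ltry//; apply/idP; lra.
Qed.

Lemma bounded_disc_integrable (f : RR -> R) (M : R) :
  measurable_fun setT f -> (forall p, D p -> `|f p| <= M) ->
  mu.-integrable D (EFin \o f).
Proof.
move=> mf fM; apply: measurable_bounded_integrable => //.
- exact: disc_finite.
- exact: measurable_funTS.
- exists M; split; first exact: num_real.
  by move=> N MN p /fM h; exact: (le_trans h (ltW MN)).
Qed.

(** The slice is empty for [r <= 0] and otherwise a chord; the fundamental theorem of calculus then
    leaves the values of [G] at the two ends [y ^ 2 = r], which vanish. *)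
Lemma slice_integral0 (G G' : R -> R) (r : R) :
  (forall y : R, is_derive y 1 G (G' y)) -> continuous G' ->
  (forall y, y ^+ 2 = r -> G y = 0) ->
  (\int[leb]_y ((G' \_ [set y | y ^+ 2 < r]) y)%:E = 0)%E.
Proof.
move=> dG cG G0.
under eq_integral => y _ do
  rewrite -[(_ y)%:E]/((EFin \o (G' \_ [set y | y ^+ 2 < r])) y) -restrict_EFin.
rewrite -integral_mkcond.
have [r0|r0] := leP r 0.
  rewrite (_ : [set y : R | y ^+ 2 < r] = set0) ?integral_set0//.
  by apply/seteqP; split=> y //=; rewrite ltNge (le_trans r0 (sqr_ge0 _)).
have s0 : 0 < Num.sqrt r by rewrite sqrtr_gt0.
have -> : [set y : R | y ^+ 2 < r] = `]- Num.sqrt r, Num.sqrt r[%classic.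
  apply/seteqP; split=> y /=; rewrite in_itv/= -ltr_norml -sqrtr_sqr ltr_sqrt//.
rewrite -(@integral_itv_bndoo _ _ _ _ true false); last first.
  by apply: measurable_funTS; apply/measurable_EFinP; exact: continuous_measurable_fun.
rewrite (FTC_derive _ dG)//; last by rewrite gtrN.
by rewrite !G0 ?subrr// ?sqrrN sqr_sqrtr// ltW.
Qed.

(** Fubini with the [y]-integral inside: the slice of the disc at [x] is the chord
    [y ^ 2 < 1 - x ^ 2], whose ends lie on the unit circle. *)
Lemma green_y (G G' : RR -> R) : mu.-integrable D (EFin \o G') ->
  (forall x y : R, is_derive y 1 (fun t => G (x, t)) (G' (x, y))) ->
  (forall x, continuous (fun t => G' (x, t))) ->
  (forall p, p.1 ^+ 2 + p.2 ^+ 2 = 1 -> G p = 0) ->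
  \int[mu]_(p in D) G' p = 0.
Proof.
move=> iG dG cG G0; rewrite /Rintegral.
have {}iG := (integrable_mkcond (EFin \o G') measurable_disc).1 iG.
rewrite integral_mkcond -integral12_prod_meas1//= integral0_eq// => x _.
rewrite /fubini_F; have := slice_integral0 (dG x) (cG x).
move=> /(_ (1 - x ^+ 2)) <-; last by move=> y hy; apply: G0; rewrite /= hy; lra.
apply: eq_integral => y _; rewrite restrict_EFin /= !patchE.
congr (if _ then _ else _)%:E.
by apply/idP/idP; rewrite !inE /disc_set/= => h; lra.
Qed.

Lemma green_x (G G' : RR -> R) : mu.-integrable D (EFin \o G') ->
  (forall x y : R, is_derive x 1 (fun t => G (t, y)) (G' (x, y))) ->
  (forall y, continuous (fun t => G' (t, y))) ->
  (forall p, p.1 ^+ 2 + p.2 ^+ 2 = 1 -> G p = 0) ->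
  \int[mu]_(p in D) G' p = 0.
Proof.
move=> iG dG cG G0; rewrite /Rintegral.
have {}iG := (integrable_mkcond (EFin \o G') measurable_disc).1 iG.
rewrite integral_mkcond -integral21_prod_meas1//= integral0_eq// => y _.
rewrite /fubini_G; have := slice_integral0 (dG^~ y) (cG y).
move=> /(_ (1 - y ^+ 2)) <-; last by move=> x hx; apply: G0; rewrite /= hx; lra.
apply: eq_integral => x _; rewrite restrict_EFin /= !patchE.
congr (if _ then _ else _)%:E.
by apply/idP/idP; rewrite !inE /disc_set/= => h; lra.
Qed.

End Green.

(** * Divergence identities for functions regular along coordinate lines *)

Section Regular.
Variable R : realType.
Local Notation leb := (@lebesgue_measure R).
Local Notation mu := (leb \x leb)%E.
Local Notation RR := (measurableTypeR R * measurableTypeR R)%type.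
Local Notation D := (@disc_set R : set RR).
Implicit Types f g : RR -> R.

(** What [green_x] and [green_y] ask of a derivative: a bound on the disc gives integrability, and
    continuity along coordinate lines feeds the fundamental theorem of calculus. The class is closed
    under sums and products. *)
Definition regular f :=
  [/\ measurable_fun setT f,
      exists M : R, forall p, D p -> `|f p| <= M,
      forall x : R, continuous (fun t : R => f (x, t)) &
      forall y : R, continuous (fun t : R => f (t, y))].

Lemma regular_integrable f : regular f -> mu.-integrable D (EFin \o f).
Proof. by move=> [mf [M fM] _ _]; exact: (bounded_disc_integrable mf fM). Qed.

Lemma regular_cst (c : R) : regular (fun=> c).
Proof.
split=> [//||x|y]; first by exists `|c|.
  by move=> t; exact: cvg_cst.
by move=> t; exact: cvg_cst.
Qed.

Lemma disc_norm (p : RR) : D p -> `|p.1 : R| <= 1 /\ `|p.2 : R| <= 1.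
Proof.
by case: p => x y; rewrite /disc_set/= => h; rewrite !ler_norml; split; apply/andP; split; nra.
Qed.

Lemma regular_fst : regular (fun p : RR => p.1).
Proof.
split=> [||x|y]; first exact: measurable_fstR.
- by exists 1 => p /disc_norm[].
- by move=> t; exact: cvg_cst.
- by move=> t; exact: cvg_id.
Qed.

Lemma regular_snd : regular (fun p : RR => p.2).
Proof.
split=> [||x|y]; first exact: measurable_sndR.
- by exists 1 => p /disc_norm[].
- by move=> t; exact: cvg_id.
- by move=> t; exact: cvg_cst.
Qed.

Lemma regularD f g : regular f -> regular g -> regular (fun p => f p + g p).
Proof.
move=> [mf [M fM] xf yf] [mg [N gN] xg yg]; split=> [||x|y].
- exact: measurable_funD.
- exists (M + N) => p pD; rewrite (le_trans (ler_normD _ _))//.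
  by rewrite lerD ?fM ?gN.
- by move=> t; apply: cvgD; [exact: xf|exact: xg].
- by move=> t; apply: cvgD; [exact: yf|exact: yg].
Qed.

Lemma regularM f g : regular f -> regular g -> regular (fun p => f p * g p).
Proof.
move=> [mf [M fM] xf yf] [mg [N gN] xg yg]; split=> [||x|y].
- exact: measurable_funM.
- exists (M * N) => p pD; rewrite normrM ler_pM ?fM ?gN//.
- by move=> t; apply: cvgM; [exact: xf|exact: xg].
- by move=> t; apply: cvgM; [exact: yf|exact: yg].
Qed.

Lemma regularN f : regular f -> regular (fun p => - f p).
Proof.
move=> rf; have := regularM (regular_cst (-1)) rf.
by congr regular; apply/funext => p; rewrite mulN1r.
Qed.

(** Continuity of [h] is asked for on positive reals only, so that [ln] and the reciprocal are
    admissible. *)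
Lemma regular_comp (h : R -> R) f : regular f -> (forall p, 0 < f p) ->
  measurable_fun setT h -> (forall t, 0 < t -> {for t, continuous h}) ->
  (exists M : R, forall p, D p -> `|h (f p)| <= M) -> regular (fun p => h (f p)).
Proof.
move=> [mf _ xf yf] f0 mh ch bh; split=> [||x|y] //.
- exact: measurableT_comp.
- by move=> t; apply: continuous_comp; [exact: xf|exact: ch].
- by move=> t; apply: continuous_comp; [exact: yf|exact: ch].
Qed.

(* [fx] and [fy] are the partial derivatives of [f]. *)
Definition smooth f fx fy :=
  [/\ regular f, regular fx, regular fy,
      forall x y : R, is_derive x (1 : R) (fun t : R => f (t, y) : R) (fx (x, y)) &
      forall x y : R, is_derive y (1 : R) (fun t : R => f (x, t) : R) (fy (x, y))].

Lemma smooth_cst (c : R) : smooth (fun=> c) (fun=> 0) (fun=> 0).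
Proof. by split=> *; [exact: regular_cst..| |]; exact: is_derive_cst. Qed.

Lemma smooth_fst : smooth (fun p => p.1) (fun=> 1) (fun=> 0).
Proof.
split=> *; [exact: regular_fst|exact: regular_cst..| |]; first exact: is_derive_id.
exact: is_derive_cst.
Qed.

Lemma smooth_snd : smooth (fun p => p.2) (fun=> 0) (fun=> 1).
Proof.
split=> *; [exact: regular_snd|exact: regular_cst..| |]; last exact: is_derive_id.
exact: is_derive_cst.
Qed.

Lemma smoothD f fx fy g gx gy : smooth f fx fy -> smooth g gx gy ->
  smooth (fun p => f p + g p) (fun p => fx p + gx p) (fun p => fy p + gy p).
Proof.
move=> [f0 f1 f2 f3 f4] [g0 g1 g2 g3 g4].
by split=> [|||x y|x y]; [exact: regularD..| |]; exact: is_deriveD.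
Qed.

Lemma smoothM f fx fy g gx gy : smooth f fx fy -> smooth g gx gy ->
  smooth (fun p => f p * g p) (fun p => f p * gx p + g p * fx p)
         (fun p => f p * gy p + g p * fy p).
Proof.
move=> [f0 f1 f2 f3 f4] [g0 g1 g2 g3 g4].
split=> [|||x y|x y]; [exact: regularM| | | |].
- by apply: regularD; exact: regularM.
- by apply: regularD; exact: regularM.
- exact: (is_deriveM (f3 x y) (g3 x y)).
- exact: (is_deriveM (f4 x y) (g4 x y)).
Qed.

Lemma smoothZ (c : R) f fx fy : smooth f fx fy ->
  smooth (fun p => c * f p) (fun p => c * fx p) (fun p => c * fy p).
Proof.
move=> sf; have := smoothM (smooth_cst c) sf.
by congr smooth; apply/funext => p; rewrite mulr0 addr0.
Qed.

(** The integrand is the divergence of [f * (- y, x)]: it is the [y]-derivative of [x * f] minus the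
    [x]-derivative of [y * f], and each integrates to zero. *)
Lemma angular_green f fx fy : smooth f fx fy ->
  (forall p, p.1 ^+ 2 + p.2 ^+ 2 = 1 -> f p = 0) ->
  \int[mu]_(p in D) (p.1 * fy p - p.2 * fx p) = 0.
Proof.
move=> sf f0; have [rf rfx rfy _ _] := sf.
have h1 := smoothM smooth_fst sf; have h2 := smoothM smooth_snd sf.
have z1 : \int[mu]_(p in D) (p.1 * fy p) = 0.
  apply: (@green_y _ (fun p => p.1 * f p)) => //.
  - by apply: regular_integrable; exact: regularM regular_fst rfy.
  - by move=> x y; have [_ _ _ _ /(_ x y)] := h1; rewrite mulr0 addr0.
  - by move=> x; have [_ _ /(_ x)] := regularM regular_fst rfy.
  - by move=> p /f0 ->; rewrite mulr0.
have z2 : \int[mu]_(p in D) (p.2 * fx p) = 0.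
  apply: (@green_x _ (fun p => p.2 * f p)) => //.
  - by apply: regular_integrable; exact: regularM regular_snd rfx.
  - by move=> x y; have [_ _ _ /(_ x y)] := h2; rewrite mulr0 addr0.
  - by move=> y; have [_ _ _ /(_ y)] := regularM regular_snd rfx.
  - by move=> p /f0 ->; rewrite mulr0.
rewrite RintegralB ?z1 ?z2 ?subrr//; first exact: measurable_disc.
  by apply: regular_integrable; exact: regularM regular_fst rfy.
by apply: regular_integrable; exact: regularM regular_snd rfx.
Qed.

(** The integrand is the divergence of [f * (x, y)]; the term [2 * f] comes from differentiating the
    two coordinates. *)
Lemma radial_green f fx fy : smooth f fx fy ->
  (forall p, p.1 ^+ 2 + p.2 ^+ 2 = 1 -> f p = 0) ->
  \int[mu]_(p in D) (2 * f p + (p.1 * fx p + p.2 * fy p)) = 0.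
Proof.
move=> sf f0; have [rf rfx rfy _ _] := sf.
have h1 := smoothM smooth_fst sf; have h2 := smoothM smooth_snd sf.
have i1 : regular (fun p => p.1 * fx p + f p).
  by apply: regularD => //; exact: regularM regular_fst rfx.
have i2 : regular (fun p => p.2 * fy p + f p).
  by apply: regularD => //; exact: regularM regular_snd rfy.
have z1 : \int[mu]_(p in D) (p.1 * fx p + f p) = 0.
  apply: (@green_x _ (fun p => p.1 * f p)) => //.
  - exact: regular_integrable.
  - by move=> x y; have [_ _ _ /(_ x y)] := h1; rewrite mulr1.
  - by move=> y; have [_ _ _ /(_ y)] := i1.
  - by move=> p /f0 ->; rewrite mulr0.
have z2 : \int[mu]_(p in D) (p.2 * fy p + f p) = 0.
  apply: (@green_y _ (fun p => p.2 * f p)) => //.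
  - exact: regular_integrable.
  - by move=> x y; have [_ _ _ _ /(_ x y)] := h2; rewrite mulr1.
  - by move=> x; have [_ _ /(_ x)] := i2.
  - by move=> p /f0 ->; rewrite mulr0.
transitivity (\int[mu]_(p in D) ((p.1 * fx p + f p) + (p.2 * fy p + f p))).
  by apply: eq_Rintegral => p _; ring.
rewrite RintegralD ?z1 ?z2 ?addr0//; first exact: measurable_disc.
  exact: regular_integrable.
exact: regular_integrable.
Qed.

End Regular.

(** * The area of the unit disc *)

Section Area.
Variable R : realType.
Local Notation leb := (@lebesgue_measure R).
Local Notation mu := (leb \x leb)%E.
Local Notation RR := (measurableTypeR R * measurableTypeR R)%type.
Local Notation D := (@disc_set R : set RR).

Lemma chord_length (r : R) :
  leb [set y : R | y ^+ 2 < r] = (2 * Num.sqrt r)%:E.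
Proof.
have [r0|r0] := leP r 0.
  rewrite (_ : [set y : R | y ^+ 2 < r] = set0) ?measure0 ?ler0_sqrtr ?mulr0//.
  by apply/seteqP; split=> y //=; rewrite ltNge (le_trans r0 (sqr_ge0 _)).
have s0 : 0 < Num.sqrt r by rewrite sqrtr_gt0.
have -> : [set y : R | y ^+ 2 < r] = `]- Num.sqrt r, Num.sqrt r[%classic.
  by apply/seteqP; split=> y /=; rewrite in_itv/= -ltr_norml -sqrtr_sqr ltr_sqrt.
by rewrite lebesgue_measure_itv/= lte_fin gtrN// -EFinD; congr (_%:E); ring.
Qed.

(** Substituting [x = sin t] turns the integrand into [2 * cos t ^ 2], with primitive
    [t + sin t * cos t]. *)
Lemma integral_semicircle :
  (\int[leb]_(x in `[(-1)%R, 1%R]) (2 * Num.sqrt (1 - x ^+ 2))%:E = pi%:E)%E.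
Proof.
have p0 : 0 < pi / 2 :> R by rewrite divr_gt0// pi_gt0.
have dsin : (@sin R)^`() = cos.
  by apply/funext => x; rewrite derive1E; have [_ ->] := is_derive_sin x.
have := @integration_by_substitution_increasing R sin
  (fun x => 2 * Num.sqrt (1 - x ^+ 2)) (- (pi / 2)) (pi / 2).
rewrite sinN sin_pihalf => ->.
- under eq_integral => x.
    rewrite inE/= in_itv/= => /andP[x1 x2].
    rewrite dsin (_ : (_ * _) x = 2 * cos x ^+ 2); last first.
      rewrite [LHS]/(2 * Num.sqrt (1 - sin x ^+ 2) * cos x).
      rewrite -cos2sin2 sqrtr_sqr ger0_norm; first by rewrite expr2 mulrA.
      by apply: cos_ge0_pihalf; rewrite x1 x2.
    over.
  have dF (x : R) : is_derive x (1 : R) (fun t : R => t + sin t * cos t) (2 * cos x ^+ 2).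
    apply: (is_derive_eq (is_deriveD (is_derive_id x 1)
      (is_deriveM (is_derive_sin x) (is_derive_cos x)))).
    by rewrite /GRing.scale /=; have := cos2Dsin2 x; lra.
  rewrite (FTC_derive _ dF).
  - by rewrite cosN cos_pihalf !mulr0 !addr0; congr (_%:E); field.
  - by rewrite gtrN.
  - by move=> x; apply: cvgM; [exact: cvg_cst|apply: cvgM; exact: continuous_cos].
- by rewrite ge0_cp// ltW.
- by move=> x y xI yI; rewrite ltr_sin.
- by rewrite dsin => x _; exact: continuous_cos.
- rewrite dsin; apply/cvg_ex; exists (cos (- (pi / 2))).
  by apply: cvg_at_right_filter; exact: continuous_cos.
- rewrite dsin; apply/cvg_ex; exists (cos (pi / 2)).
  by apply: cvg_at_left_filter; exact: continuous_cos.
- split=> [x _||]; first by have [] := is_derive_sin x.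
    by apply: cvg_at_right_filter; exact: continuous_sin.
  by apply: cvg_at_left_filter; exact: continuous_sin.
- apply: continuous_subspaceT => x; apply: cvgM; first exact: cvg_cst.
  apply: continuous_comp; last exact: sqrt_continuous.
  by apply: cvgB; [exact: cvg_cst|exact: exprn_continuous].
Qed.

Lemma disc_area : mu D = pi%:E.
Proof.
rewrite -[LHS]mul1e -integral_cst; last exact: measurable_disc.
have iD : mu.-integrable D (EFin \o cst 1).
  by apply: (@bounded_disc_integrable _ _ 1) => // p _; rewrite normr1.
have {}iD := (integrable_mkcond _ (@measurable_disc R)).1 iD.
rewrite -[LHS]/(\int[mu]_(x in D) (EFin \o cst (1 : R)%R) x)%E.
rewrite integral_mkcond -integral12_prod_meas1//=.
rewrite -integral_semicircle [RHS]integral_mkcond; apply: eq_integral => x _.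
rewrite /fubini_F.
transitivity (\int[leb]_(y in [set y : R | (y ^+ 2 < 1 - x ^+ 2)%R]) (1%R)%:E)%E.
  rewrite [RHS]integral_mkcond; apply: eq_integral => y _.
  rewrite !patchE; congr (if _ then _ else _).
  by apply/idP/idP; rewrite !inE /disc_set/= => h; lra.
rewrite integral_cst ?mul1e; last first.
  rewrite [X in measurable X](_ : _ = (fun y : R => y ^+ 2) @^-1` `]-oo, 1 - x ^+ 2[%classic); last first.
    by apply/seteqP; split => y; rewrite /= in_itv.
  rewrite -[X in measurable X]setTI; apply: measurable_funX => //.
transitivity (2 * Num.sqrt (1 - x ^+ 2))%:E; first exact: chord_length.
(* Outside [[-1, 1]] the radicand is negative and [Num.sqrt] returns [0], so restricting to the
   interval changes nothing. *)
rewrite patchE; case: ifPn => //.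
rewrite notin_setE /= in_itv/= => /negP h; rewrite ler0_sqrtr ?mulr0//.
by move: h; rewrite -ler_norml -ltNge -(@ltr_pXn2r _ 2) ?nnegrE// real_normK ?num_real// expr1n; lra.
Qed.

End Area.

(** * Moments of the logarithmic weight *)

Section Moments.
Variable R : realType.
Local Notation leb := (@lebesgue_measure R).
Local Notation mu := (leb \x leb)%E.
Local Notation RR := (measurableTypeR R * measurableTypeR R)%type.
Local Notation D := (@disc_set R : set RR).
Implicit Types f g : RR -> R.

Definition rho (p : RR) : R := p.1 ^+ 2 + p.2 ^+ 2.

Lemma rho_ge0 p : 0 <= rho p.
Proof. by rewrite addr_ge0// sqr_ge0. Qed.

(** In complex form: [f + i g] is an eigenfunction of the rotation field [x d_y - y d_x] with
    eigenvalue [i n]. *)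
Definition rot_eigen (n : R) f g := exists fx fy gx gy,
  [/\ smooth f fx fy, smooth g gx gy,
      forall p, p.1 * fy p - p.2 * fx p = - n * g p &
      forall p, p.1 * gy p - p.2 * gx p = n * f p].

(** By the Leibniz rule the eigenvalues of a product add up; the two functions are the real and
    imaginary parts of the complex product. *)
Lemma rot_eigenM n m f g f' g' : rot_eigen n f g -> rot_eigen m f' g' ->
  rot_eigen (n + m) (fun p => f p * f' p - g p * g' p)
                    (fun p => f p * g' p + g p * f' p).
Proof.
move=> [fx [fy [gx [gy [sf sg hf hg]]]]] [fx' [fy' [gx' [gy' [sf' sg' hf' hg']]]]].
have h1 := smoothD (smoothM sf sf') (smoothZ (-1) (smoothM sg sg')).
have h2 := smoothD (smoothM sf sg') (smoothM sg sf').
do 4 eexists; split.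
- by move: h1; congr smooth; apply/funext => p; rewrite mulN1r.
- exact: h2.
- move=> p; have e1 := hf p; have e2 := hg p; have e3 := hf' p; have e4 := hg' p.
  rewrite /=.
  transitivity (f p * (p.1 * fy' p - p.2 * fx' p) + f' p * (p.1 * fy p - p.2 * fx p)
    - g p * (p.1 * gy' p - p.2 * gx' p) - g' p * (p.1 * gy p - p.2 * gx p)).
    by ring.
  by rewrite e1 e2 e3 e4; ring.
- move=> p; have e1 := hf p; have e2 := hg p; have e3 := hf' p; have e4 := hg' p.
  rewrite /=.
  transitivity (f p * (p.1 * gy' p - p.2 * gx' p) + g' p * (p.1 * fy p - p.2 * fx p)
    + g p * (p.1 * fy' p - p.2 * fx' p) + f' p * (p.1 * gy p - p.2 * gx p)).
    by ring.
  by rewrite e1 e2 e3 e4; ring.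
Qed.

Definition monom (j k : nat) (p : RR) : R[i] :=
  ((p.1 : R) +i* (p.2 : R)) ^+ j * ((p.1 : R) -i* (p.2 : R)) ^+ k.

(** The coordinate [w] has index [1] and its conjugate has index [-1]; [rot_eigenM] accumulates
    them, first over [k], then over [j]. *)
Lemma rot_eigen_monom j k : rot_eigen (j%:R - k%:R)
  (fun p => complex.Re (monom j k p)) (fun p => complex.Im (monom j k p)).
Proof.
elim: k => [|k IH]; last first.
  have e : rot_eigen (-1) (fun p : RR => p.1 : R) (fun p : RR => - p.2 : R).
    exists (fun=> 1), (fun=> 0), (fun=> 0), (fun=> -1); split.
    - exact: smooth_fst.
    - have := smoothZ (-1) (@smooth_snd R).
      by congr smooth; apply/funext => p; rewrite ?mulr0 ?mulr1 ?mulN1r.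
    - by move=> p /=; ring.
    - by move=> p /=; ring.
  have := rot_eigenM IH e; congr rot_eigen.
  - by rewrite -[in RHS]natr1; ring.
  - apply/funext => p; rewrite /monom exprSr mulrA -/(monom j k p).
    by case: (monom j k p) => a b /=; ring.
  - apply/funext => p; rewrite /monom exprSr mulrA -/(monom j k p).
    by case: (monom j k p) => a b /=; ring.
rewrite subr0; elim: j => [|j IH].
  exists (fun=> 0), (fun=> 0), (fun=> 0), (fun=> 0); split.
  - have := @smooth_cst R 1; congr smooth.
    by apply/funext => p; rewrite /monom !expr0 mulr1.
  - have := @smooth_cst R 0; congr smooth.
    by apply/funext => p; rewrite /monom !expr0 mulr1.
  - by move=> p; rewrite /monom !expr0 mulr1 /=; ring.
  - by move=> p; rewrite /monom !expr0 mulr1 /=; ring.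
have e : rot_eigen 1 (fun p : RR => p.1 : R) (fun p : RR => p.2 : R).
  exists (fun=> 1), (fun=> 0), (fun=> 0), (fun=> 1); split.
  - exact: smooth_fst.
  - exact: smooth_snd.
  - by move=> p /=; ring.
  - by move=> p /=; ring.
have := rot_eigenM IH e; congr rot_eigen.
- by rewrite natr1.
- apply/funext => p; rewrite /monom exprSr mulrAC -/(monom j 0 p).
  by case: (monom j 0 p) => a b /=; ring.
- apply/funext => p; rewrite /monom exprSr mulrAC -/(monom j 0 p).
  by case: (monom j 0 p) => a b /=; ring.
Qed.

Lemma monom_diag j p : monom j j p = (rho p ^+ j)%:C.
Proof.
rewrite /monom -exprMn rmorphXn /=; congr (_ ^+ _).
by apply/eqP; rewrite eq_complex /= /rho; apply/andP; split; apply/eqP; ring.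
Qed.

(** A weight [h] killed by the rotation field behaves as a constant: the angular derivative of
    [g * h] is [n * f * h] and that of [f * h] is [- n * g * h]. Both integrate to zero by
    [angular_green], and [n] can be cancelled. *)
Lemma rot_eigen_integral0 n f g h hx hy : n != 0 -> rot_eigen n f g ->
  smooth h hx hy -> (forall p, p.1 * hy p - p.2 * hx p = 0) ->
  (forall p, rho p = 1 -> h p = 0) ->
  \int[mu]_(p in D) (f p * h p) = 0 /\ \int[mu]_(p in D) (g p * h p) = 0.
Proof.
move=> n0 [fx [fy [gx [gy [sf sg hf hg]]]]] sh hr h0.
have [rf _ _ _ _] := sf; have [rg _ _ _ _] := sg; have [rh _ _ _ _] := sh.
have mD := @measurable_disc R.
have i1 := regular_integrable (regularM rf rh).
have i2 := regular_integrable (regularM rg rh).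
have e1 := angular_green (smoothM sf sh); have e2 := angular_green (smoothM sg sh).
split; apply: (mulfI n0); rewrite mulr0 -RintegralZl//.
  rewrite -[RHS]e2; last by move=> p /h0 ->; rewrite mulr0.
  apply: eq_Rintegral => p _ /=.
  transitivity (g p * (p.1 * hy p - p.2 * hx p) + h p * (p.1 * gy p - p.2 * gx p)).
    by rewrite hr hg; ring.
  by ring.
rewrite -[RHS]oppr0 -[in RHS]e1; last by move=> p /h0 ->; rewrite mulr0.
rewrite -[RHS]mulN1r -RintegralZl//; last first.
  apply: regular_integrable.
  have [_ r1 r2 _ _] := smoothM sf sh.
  by have := regularD (regularM (@regular_fst R) r2) (regularN (regularM (@regular_snd R) r1)).
apply: eq_Rintegral => p _ /=.
transitivity (- (f p * (p.1 * hy p - p.2 * hx p) + h p * (p.1 * fy p - p.2 * fx p))).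
  by rewrite hr hf; ring.
by ring.
Qed.

(** Euler's relation for functions homogeneous of degree [n]. *)
Definition radial_homog (n : R) f := exists fx fy,
  smooth f fx fy /\ forall p, p.1 * fx p + p.2 * fy p = n * f p.

Lemma smooth_rho : smooth rho (fun p => 2 * p.1) (fun p => 2 * p.2).
Proof.
have := smoothD (smoothM (@smooth_fst R) (@smooth_fst R)) (smoothM (@smooth_snd R) (@smooth_snd R)).
by congr smooth; apply/funext => p; rewrite ?/rho ?expr2; ring.
Qed.

Lemma radial_homog_rho j : radial_homog (2 * j%:R) (fun p => rho p ^+ j).
Proof.
elim: j => [|j [fx [fy [sf hf]]]].
  by exists (fun=> 0), (fun=> 0); split; [exact: smooth_cst|move=> p; ring].
do 2 eexists; split.
  by have := smoothM smooth_rho sf; under [X in smooth X]eq_fun do rewrite -exprS; exact.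
move=> p /=.
transitivity (rho p * (p.1 * fx p + p.2 * fy p) + 2 * (p.1 ^+ 2 + p.2 ^+ 2) * rho p ^+ j).
  by ring.
by rewrite hf -/(rho p) exprS -natr1; ring.
Qed.

Lemma regular_rhoX j : regular (fun p => rho p ^+ j).
Proof. by have [fx [fy [[]]]] := radial_homog_rho j. Qed.

End Moments.

(** * Moments of the regularised weight *)

Section LogMoments.
Variable R : realType.
Local Notation leb := (@lebesgue_measure R).
Local Notation mu := (leb \x leb)%E.
Local Notation RR := (measurableTypeR R * measurableTypeR R)%type.
Local Notation D := (@disc_set R : set RR).
Implicit Types f g : RR -> R.
Let mD : measurable D := @measurable_disc R.
Local Hint Resolve mD : core.

Lemma integral_disc_cst (c : R) : \int[mu]_(p in D) c = c * pi.
Proof.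
by rewrite Rintegral_cst//; congr (_ * _); exact: (congr1 fine (disc_area R)).
Qed.

(** [radial_green] applies to [rho ^ j - 1], which vanishes on the circle; the divergence is
    [2 (j + 1) rho ^ j - 2], so the moment is the area divided by [j + 1]. *)
Lemma integral_rhoX j : \int[mu]_(p in D) (rho p ^+ j) = pi / j.+1%:R.
Proof.
have [fx [fy [sf hf]]] := @radial_homog_rho R j.
have rj := @regular_rhoX R j; have ij := regular_integrable rj.
have := radial_green (smoothD sf (@smooth_cst R (-1))).
move=> /(_ _) h; have {}h := h _.
have i1 := @regular_integrable _ _ (@regular_cst R 2).
have i2 := @regular_integrable _ _ (regularM (@regular_cst R (2 * j.+1%:R)) rj).
have : \int[mu]_(p in D) (2 * j.+1%:R * rho p ^+ j - 2) = 0.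
  rewrite -[RHS]h; last by move=> p hp; rewrite /rho hp expr1n subrr.
  apply: eq_Rintegral => p _ /=; rewrite !addr0 hf -[in LHS]natr1; ring.
rewrite RintegralB// RintegralZl// integral_disc_cst => e.
have j0 : (j.+1%:R : R) != 0 by rewrite pnatr_eq0.
apply: (mulfI j0); rewrite mulrCA divff// mulr1; lra.
Qed.

(** The weight [L_e]: the shift by [e] removes the singularity at the origin, and the constant
    [ln (1 + e)] makes it vanish on the circle. *)
Definition rlog (e : R) (p : RR) : R := ln (1 + e) - ln (rho p + e).
Definition logw2 (p : RR) : R := logw ((p.1 : R) +i* (p.2 : R)).

Lemma logw2E p : logw2 p = - ln (rho p).
Proof.
rewrite /logw2 /logw /csqn /= -/(rho p).
have := rho_ge0 p; rewrite le_eqVlt => /orP[/eqP <-|p0]; last by rewrite lnV.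
(* At the origin the conventions [0^-1 = 0] and [ln 0 = 0] make both sides [0]. *)
by rewrite invr0 ln0// oppr0.
Qed.

Lemma measurable_rhoR : measurable_fun setT (@rho R).
Proof. exact: (@measurable_rho R). Qed.

Lemma measurable_logw2 : measurable_fun setT logw2.
Proof.
rewrite (_ : logw2 = fun p => - ln (rho p)); last by apply/funext => p; exact: logw2E.
by apply: measurable_funN; apply: measurableT_comp => //; exact: measurable_rhoR.
Qed.

Lemma logw2_ge0 p : D p -> 0 <= logw2 p.
Proof. by rewrite /disc_set /= -/(rho p) logw2E oppr_ge0 => /ltW /ln_le0. Qed.

Section Regularised.
Variable e : R.
Hypothesis e0 : 0 < e.

Let re0 p : 0 < rho p + e.
Proof. by rewrite ltr_wpDl// rho_ge0. Qed.

Lemma rlog_ge0 p : D p -> 0 <= rlog e p.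
Proof.
rewrite /disc_set /= -/(rho p) => p1; rewrite subr_ge0 ler_ln ?posrE//; last by rewrite addr_gt0.
by rewrite lerD2r ltW.
Qed.

(** This is [(1 + e) * rho p <= rho p + e], true as [rho p <= 1]. The origin is excluded because
    [logw2] takes the conventional value [0] there. *)
Lemma rlog_le p : D p -> 0 < rho p -> rlog e p <= logw2 p.
Proof.
rewrite /disc_set /= -/(rho p) => p1 p0; rewrite logw2E /rlog.
have e1 : 0 < 1 + e by rewrite addr_gt0.
suff : ln (1 + e) + ln (rho p) <= ln (rho p + e) by lra.
by rewrite -lnM ?posrE// ler_ln ?posrE ?mulr_gt0// mulrDl mul1r lerD2l ler_piMr// ltW.
Qed.

Lemma regular_shift : regular (fun p => rho p + e).
Proof. by apply: regularD; [exact: (@regular_rhoX R 1)|exact: regular_cst]. Qed.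

Lemma regular_shiftV : regular (fun p => (rho p + e)^-1).
Proof.
(* The reciprocal is rewritten as [exp (- ln t)], which is measurable on the whole line and
   continuous at positive [t]. *)
have E p : expR (- ln (rho p + e)) = (rho p + e)^-1 by rewrite expRN lnK// posrE.
under eq_fun do rewrite -E.
apply: (@regular_comp _ (fun t => expR (- ln t))); [exact: regular_shift|exact: re0| | |].
- apply: measurableT_comp; first exact: measurable_expR.
  by apply: measurable_funN.
- move=> t t0; apply: continuous_comp; last exact: continuous_expR.
  by apply: cvgN; exact: continuous_ln.
- exists e^-1 => p _; rewrite E ger0_norm ?invr_ge0 ?(ltW (re0 p))//.
  by rewrite lef_pV2 ?posrE// lerDr rho_ge0.
Qed.

Lemma regular_rlog : regular (rlog e).
Proof.
apply: regularD; first exact: regular_cst.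
apply: regularN; apply: regular_comp; [exact: regular_shift|exact: re0| | |].
- exact: measurable_ln.
- by move=> t; exact: continuous_ln.
- exists (`|ln e| + `|ln (1 + e)|) => p; rewrite /disc_set /= -/(rho p) => p1.
  have e1 : 0 < 1 + e by rewrite addr_gt0.
  have h1 : ln e <= ln (rho p + e) by rewrite ler_ln ?posrE// lerDr rho_ge0.
  have h2 : ln (rho p + e) <= ln (1 + e) by rewrite ler_ln ?posrE// lerD2r ltW.
  rewrite ler_norml; apply/andP; split.
    by have := ler_norm (- ln e); rewrite normrN; have := normr_ge0 (ln (1 + e)); lra.
  by have := ler_norm (ln (1 + e)); have := normr_ge0 (ln e); lra.
Qed.

Lemma smooth_rlog : smooth (rlog e) (fun p => - (rho p + e)^-1 * (2 * p.1))
  (fun p => - (rho p + e)^-1 * (2 * p.2)).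
Proof.
have [_ r1 r2 d1 d2] := @smooth_rho R.
split; [exact: regular_rlog| | | |].
- by apply: regularM r1; apply: regularN; exact: regular_shiftV.
- by apply: regularM r2; apply: regularN; exact: regular_shiftV.
- move=> x y; have ds := is_deriveD (d1 x y) (is_derive_cst e (x : R) (1 : R)).
  have dl := @is_derive1_comp R (@ln R) ((fun t : R => rho (t, y)) + cst e) x _ _ (is_derive1_ln (re0 (x, y))) ds.
  apply: (is_derive_eq (is_deriveD (is_derive_cst (ln (1 + e)) (x : R) (1 : R)) (is_deriveN dl))).
  by rewrite add0r addr0 mulNr.
- move=> x y; have ds := is_deriveD (d2 x y) (is_derive_cst e (y : R) (1 : R)).
  have dl := @is_derive1_comp R (@ln R) ((fun t : R => rho (x, t)) + cst e) y _ _ (is_derive1_ln (re0 (x, y))) ds.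
  apply: (is_derive_eq (is_deriveD (is_derive_cst (ln (1 + e)) (y : R) (1 : R)) (is_deriveN dl))).
  by rewrite add0r addr0 mulNr.
Qed.

Lemma rlog_circle p : rho p = 1 -> rlog e p = 0.
Proof. by rewrite /rlog => ->; rewrite subrr. Qed.

Lemma integral_monom_rlog j k : j <> k ->
  \int[mu]_(p in D) (complex.Re (monom j k p) * rlog e p) = 0 /\
  \int[mu]_(p in D) (complex.Im (monom j k p) * rlog e p) = 0.
Proof.
move=> jk; apply: (rot_eigen_integral0 _ (rot_eigen_monom R j k) smooth_rlog).
- by rewrite subr_eq0 eqr_nat; apply/eqP.
- by move=> p; ring.
- exact: rlog_circle.
Qed.

Lemma integral_rhoX_rlog j : \int[mu]_(p in D) (rho p ^+ j * rlog e p) =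
  j.+1%:R^-1 * \int[mu]_(p in D) (rho p ^+ j.+1 * (rho p + e)^-1).
Proof.
have [fx [fy [sf hf]]] := @radial_homog_rho R j.
have i1 := regular_integrable (regularM (@regular_rhoX R j) regular_rlog).
have i2 := regular_integrable (regularM (@regular_rhoX R j.+1) regular_shiftV).
have i3 := regular_integrable (regularM (@regular_cst R (2 * j.+1%:R))
  (regularM (@regular_rhoX R j) regular_rlog)).
have i4 := regular_integrable (regularM (@regular_cst R 2)
  (regularM (@regular_rhoX R j.+1) regular_shiftV)).
have h := radial_green (smoothM sf smooth_rlog).
have : \int[mu]_(p in D) (2 * j.+1%:R * (rho p ^+ j * rlog e p) -
    2 * (rho p ^+ j.+1 * (rho p + e)^-1)) = 0.
  rewrite -[RHS]h; last by move=> p /rlog_circle ->; rewrite mulr0.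
  apply: eq_Rintegral => p _ /=.
  transitivity (2 * (rho p ^+ j * rlog e p) + (rlog e p * (p.1 * fx p + p.2 * fy p)
    - 2 * (p.1 ^+ 2 + p.2 ^+ 2) * rho p ^+ j * (rho p + e)^-1)); last by ring.
  by rewrite hf -/(rho p) -natr1 exprS; ring.
rewrite RintegralB// !RintegralZl// => e1.
have j0 : (j.+1%:R : R) != 0 by rewrite pnatr_eq0.
by apply: (mulfI j0); rewrite mulrA divff// mul1r; lra.
Qed.

(** Since [rho / (rho + e) <= 1], the bound is uniform in [e], as Fatou's lemma will require. *)
Lemma integral_rhoX_rlog_le j :
  \int[mu]_(p in D) (rho p ^+ j * rlog e p) <= pi / j.+1%:R ^+ 2.
Proof.
rewrite integral_rhoX_rlog expr2 invfM mulrA mulrC ler_wpM2r ?invr_ge0//.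
rewrite -integral_rhoX; apply: le_Rintegral => //.
- exact: regular_integrable (regularM (@regular_rhoX R j.+1) regular_shiftV).
- exact: regular_integrable (@regular_rhoX R j).
- move=> p _; rewrite ler_pdivrMr// mulrDr -exprSr lerDl mulr_ge0 ?exprn_ge0 ?rho_ge0//.
  exact: ltW.
Qed.

End Regularised.

End LogMoments.

(** * Moments of the logarithm, by letting [e] tend to zero *)

Section LogLimits.
Variable R : realType.
Local Notation leb := (@lebesgue_measure R).
Local Notation mu := (leb \x leb)%E.
Local Notation RR := (measurableTypeR R * measurableTypeR R)%type.
Local Notation D := (@disc_set R : set RR).
Implicit Types f g : RR -> R.
Let mD : measurable D := @measurable_disc R.
Local Hint Resolve mD : core.

(** The origin, where the regularised weights do not converge to [logw2], is a null set. *)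
Lemma ae_rho_gt0 : {ae mu, forall p : RR, 0 < rho p}.
Proof.
exists ([set 0] `*` [set 0]); split.
- exact: measurableX.
- by rewrite [LHS]product_measure1E// [X in (X * _)%E]lebesgue_measure_set1 mul0e.
- move=> [x y] /= /negP; rewrite /rho/= -leNgt => h.
  by split=> /=; apply/eqP; rewrite -sqrf_eq0; apply/eqP; have := sqr_ge0 x; have := sqr_ge0 y; lra.
Qed.

Lemma Rintegral_dominated_cvg (f_ : nat -> RR -> R) f (g : RR -> \bar R) :
  (forall n, measurable_fun D (f_ n)) -> measurable_fun D f ->
  {ae mu, forall p, D p -> f_ n p @[n --> \oo] --> f p} ->
  mu.-integrable D g ->
  {ae mu, forall p, forall n, D p -> (`|(f_ n p)%:E| <= g p)%E} ->
  mu.-integrable D (EFin \o f) /\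
  \int[mu]_(p in D) f_ n p @[n --> \oo] --> \int[mu]_(p in D) f p.
Proof.
move=> mf_ mf cf ig fg.
have cf' : {ae mu, forall p, D p -> (f_ n p)%:E @[n --> \oo] --> (f p)%:E}.
  by apply: filterS cf => p h Dp; apply: cvg_EFin; [exact: nearW|exact: h].
have [] := dominated_convergence mD _ _ cf' ig fg.
- by move=> n; apply/measurable_EFinP.
- exact/measurable_EFinP.
move=> intf _ cvf.
split=> //; apply: fine_cvg.
by rewrite fineK//; apply: integrable_fin_num.
Qed.

Lemma rlog_cvg (p : RR) : 0 < rho p -> rlog (n.+1%:R^-1 : R) p @[n --> \oo] --> logw2 p.
Proof.
move=> p0; rewrite logw2E -[X in _ --> X]sub0r -(ln1 R).
have h : (n.+1%:R^-1 : R) @[n --> \oo] --> (0 : R) by exact: cvg_harmonic.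
apply: cvgB.
  apply: continuous_cvg; first exact: continuous_ln.
  by rewrite -[X in _ --> X]addr0; apply: cvgD => //; exact: cvg_cst.
apply: continuous_cvg; first exact: continuous_ln.
by rewrite -[X in _ --> X]addr0; apply: cvgD => //; exact: cvg_cst.
Qed.


(** Fatou's lemma along [e = 1 / (n + 1)] with the bound uniform in [e]. The integral is
    extended-real because integrability of [logw2] is not known yet; it follows from the case
    [j = 0]. *)
Lemma integral_rhoX_logw2_le j :
  (\int[mu]_(p in D) (rho p ^+ j * logw2 p)%:E <= (pi / j.+1%:R ^+ 2)%:E)%E.
Proof.
have [N [mN N0 sN]] := ae_rho_gt0.
have mf : measurable_fun setT (fun p : RR => rho p ^+ j * logw2 p).
  apply: measurable_funM; last exact: measurable_logw2.
  by apply: measurable_funX; exact: measurable_rhoR.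
pose r n p := (rho p ^+ j * rlog n.+1%:R^-1 p : R).
have rr n : regular (r n).
  by apply: regularM; [exact: regular_rhoX|apply: regular_rlog; rewrite invr_gt0].
have r0 n p : D p -> (0 <= (r n p)%:E)%E.
  move=> Dp; rewrite lee_fin mulr_ge0 ?exprn_ge0 ?rho_ge0//.
  by apply: rlog_ge0 => //; rewrite invr_gt0.
have mr n : measurable_fun setT (EFin \o r n).
  by apply/measurable_EFinP; have [] := rr n.
have mDN : measurable (D `\` N) by exact: measurableD.
rewrite (ge0_negligible_integral mN)//; last 2 first.
- by apply/measurable_EFinP; exact: measurable_funTS.
- by move=> p Dp; rewrite lee_fin mulr_ge0 ?exprn_ge0 ?rho_ge0// logw2_ge0.
have E p : (D `\` N) p -> limn_einf (fun n => (r n p)%:E) = (rho p ^+ j * logw2 p)%:E.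
  move=> [Dp Np]; have p0 : 0 < rho p by apply: contrapT => h; apply: Np; exact: sN.
  have c : (r n p)%:E @[n --> \oo] --> (rho p ^+ j * logw2 p)%:E.
    apply: cvg_EFin; first exact: nearW.
    by apply: cvgMl_tmp; exact: rlog_cvg.
  by have [-> _] := cvg_limn_einf_sup c.
under eq_integral => p do [rewrite inE => /E <-].
apply: (le_trans (fatou _ _ _ _)) => //.
- by move=> n; apply: measurable_funTS; exact: mr.
- by move=> n p [Dp _]; exact: r0.
(* The lower limit is the limit of the infima over tails, and each infimum is at most the first
   integral of its tail. *)
rewrite limn_einf_lim; apply: lime_le; first exact: is_cvg_einfs.
apply: nearW => n; apply: (@le_trans _ _ (\int[mu]_(p in D `\` N) (r n p)%:E)%E).
  by apply: ereal_inf_lbound; exists n => //=.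
apply: (@le_trans _ _ (\int[mu]_(p in D) (r n p)%:E)%E).
  apply: ge0_subset_integral => //; first by apply: measurable_funTS; exact: mr.
  by move=> p; exact: r0.
rewrite -(fineK (integrable_fin_num mD (regular_integrable (rr n)))) lee_fin.
by apply: integral_rhoX_rlog_le; rewrite invr_gt0.
Qed.

Lemma integrable_logw2 : mu.-integrable D (EFin \o @logw2 R).
Proof.
apply/integrableP; split.
  by apply/measurable_EFinP; apply: measurable_funTS; exact: measurable_logw2.
apply: le_lt_trans (ltry (pi / 1%:R ^+ 2)).
apply: le_trans (integral_rhoX_logw2_le 0).
rewrite le_eqVlt; apply/orP; left; apply/eqP; apply: eq_integral => p.
rewrite inE => Dp; rewrite expr0 mul1r gee0_abs//.
by rewrite lee_fin; exact: logw2_ge0.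
Qed.

(** Dominated convergence: off the origin [rlog] lies below [logw2], so [M * logw2] is an integrable
    majorant when [M] bounds [f]. *)
Lemma cvg_integral_rlog f : regular f ->
  mu.-integrable D (EFin \o (fun p => f p * logw2 p)) /\
  (fun n : nat => \int[mu]_(p in D) (f p * rlog (n.+1%:R^-1 : R) p)) @ \oo -->
  (\int[mu]_(p in D) (f p * logw2 p) : R).
Proof.
move=> rf; have [mf [M fM] _ _] := rf.
have e0 n : 0 < n.+1%:R^-1 :> R by rewrite invr_gt0.
apply: (@Rintegral_dominated_cvg _ _ (fun p => (M%:E * (EFin \o @logw2 R) p)%E)).
- move=> n; apply: measurable_funTS.
  by have [] := regularM rf (regular_rlog (e0 n)).
- apply: measurable_funTS; apply: measurable_funM => //; exact: measurable_logw2.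
- by apply: filterS ae_rho_gt0 => p p0 _; apply: cvgMl_tmp; exact: rlog_cvg.
- by apply: integrableZl => //; exact: integrable_logw2.
- apply: filterS ae_rho_gt0 => p p0 n Dp.
  rewrite /= lee_fin normrM ler_pM ?fM//.
  by rewrite ger0_norm ?rlog_ge0// rlog_le.
Qed.

Lemma integral_monom_logw2 j k : j <> k ->
  \int[mu]_(p in D) (complex.Re (monom j k p) * logw2 p) = 0 /\
  \int[mu]_(p in D) (complex.Im (monom j k p) * logw2 p) = 0.
Proof.
move=> jk; have [fx [fy [gx [gy [[rf _ _ _ _] [rg _ _ _ _] _ _]]]]] := rot_eigen_monom R j k.
have [_ c1] := cvg_integral_rlog rf; have [_ c2] := cvg_integral_rlog rg.
have e0 n : 0 < n.+1%:R^-1 :> R by rewrite invr_gt0.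
split.
  apply: (cvg_unique (@Rhausdorff R) c1).
  rewrite (_ : (fun n : nat => _) = cst 0); first exact: cvg_cst.
  by apply/funext => n; exact: (integral_monom_rlog (e0 n) jk).1.
apply: (cvg_unique (@Rhausdorff R) c2).
rewrite (_ : (fun n : nat => _) = cst 0); first exact: cvg_cst.
by apply/funext => n; exact: (integral_monom_rlog (e0 n) jk).2.
Qed.

(** Both sides of [integral_rhoX_rlog] pass to the limit. On the right, [rho ^ (j + 1) / (rho + e)]
    is at most [1] and tends to [rho ^ j] off the origin, which leaves [integral_rhoX]. *)
Lemma integral_rhoX_logw2 j :
  \int[mu]_(p in D) (rho p ^+ j * logw2 p) = pi / j.+1%:R ^+ 2.
Proof.
have e0 n : 0 < n.+1%:R^-1 :> R by rewrite invr_gt0.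
have [_ c1] := cvg_integral_rlog (@regular_rhoX R j).
apply: (cvg_unique (@Rhausdorff R) c1) => /=.
rewrite [X in X @ _](_ : _ = (fun n : nat => j.+1%:R^-1 *
  \int[mu]_(p in D) (rho p ^+ j.+1 * (rho p + n.+1%:R^-1)^-1))); last first.
  by apply/funext => n; exact: integral_rhoX_rlog.
rewrite expr2 invfM mulrA mulrC; apply: cvgMl_tmp; rewrite -integral_rhoX.
have [mj _ _ _] := @regular_rhoX R j.
apply: (@Rintegral_dominated_cvg _ _ (EFin \o (fun=> 1)) _ _ _ _ _).2.
- move=> n; apply: measurable_funTS.
  by have [] := regularM (@regular_rhoX R j.+1) (regular_shiftV (e0 n)).
- exact: measurable_funTS.
- apply: filterS ae_rho_gt0 => p p0 _.
  have -> : rho p ^+ j = rho p ^+ j.+1 * (rho p + 0)^-1.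
    by rewrite addr0 exprSr mulfK// gt_eqF.
  apply: cvgMl_tmp; apply: cvgV; first by rewrite addr0 gt_eqF.
  by apply: cvgD; [exact: cvg_cst|exact: cvg_harmonic].
- exact: regular_integrable (@regular_cst R 1).
- apply: aeW => p n Dp; rewrite /= lee_fin.
  have p1 : 0 < rho p + n.+1%:R^-1 by rewrite ltr_wpDl// rho_ge0.
  rewrite ger0_norm ?mulr_ge0 ?exprn_ge0 ?rho_ge0 ?invr_ge0 ?(ltW p1)//.
  rewrite ler_pdivrMr// mul1r exprS.
  have h : rho p ^+ j <= 1 by rewrite exprn_ile1 ?rho_ge0// ltW.
  apply: (@le_trans _ _ (rho p)); first by rewrite ler_piMr ?rho_ge0.
  by rewrite lerDl ltW.
Qed.

Lemma integral_ReIm_monom_logw2 j k :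
  \int[mu]_(p in D) (complex.Re (monom j k p) * logw2 p) =
    (j == k)%:R * (pi / j.+1%:R ^+ 2) /\
  \int[mu]_(p in D) (complex.Im (monom j k p) * logw2 p) = 0.
Proof.
have [<-|/eqP jk] := eqVneq j k; last by rewrite mul0r; exact: integral_monom_logw2.
rewrite mul1r -integral_rhoX_logw2; split.
  by apply: eq_Rintegral => p _; rewrite monom_diag.
under eq_Rintegral do rewrite monom_diag /= mul0r.
by rewrite integral_disc_cst mul0r.
Qed.

Lemma integrable_monom_logw2 j k :
  mu.-integrable D (EFin \o (fun p => complex.Re (monom j k p) * logw2 p)) /\
  mu.-integrable D (EFin \o (fun p => complex.Im (monom j k p) * logw2 p)).
Proof.
have [fx [fy [gx [gy [[rf _ _ _ _] [rg _ _ _ _] _ _]]]]] := rot_eigen_monom R j k.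
by split; [exact: (cvg_integral_rlog rf).1|exact: (cvg_integral_rlog rg).1].
Qed.

End LogLimits.

(** * Power series on the disc *)

Section PowerSeries.
Variable R : realType.
Local Notation C := R[i].
Implicit Types (z w h : C) (a : nat -> C).

Lemma cvg_series_bounded_sum (u : nat -> R) (K : R) :
  (forall n, 0 <= u n) -> (forall N, \sum_(0 <= n < N) u n <= K) -> cvgn (series u).
Proof.
move=> u0 uK; apply: nondecreasing_is_cvgn; first exact: nondecreasing_series.
by exists K => _ [n _ <-]; exact: uK.
Qed.

(* Summation by parts: multiplying by [1 - r] lowers the degree of the weight. *)
Lemma weighted_geometric_step (u : nat -> R) (r : R) N :
  (1 - r) * \sum_(0 <= n < N) u n * r ^+ n + u N * r ^+ N =
  u 0 + r * \sum_(0 <= n < N) (u n.+1 - u n) * r ^+ n.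
Proof.
elim: N => [|N IH]; first by rewrite !big_nil !mulr0 add0r addr0 expr0 mulr1.
rewrite !big_nat_recr //= exprS !mulrDr addrA -IH; ring.
Qed.

Lemma weighted_geometric_bound (u v : nat -> R) (r K : R) : 0 <= r < 1 ->
  (forall n, 0 <= u n) -> (forall n, u n.+1 - u n <= v n) ->
  (forall N, \sum_(0 <= n < N) v n * r ^+ n <= K) ->
  forall N, \sum_(0 <= n < N) u n * r ^+ n <= (u 0 + r * K) / (1 - r).
Proof.
move=> /andP[r0 r1] u0 uv vK N; rewrite ler_pdivlMr ?subr_gt0// mulrC.
apply: le_trans (_ : u 0 + r * \sum_(0 <= n < N) (u n.+1 - u n) * r ^+ n <= _).
  by rewrite -weighted_geometric_step lerDl mulr_ge0 ?exprn_ge0.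
rewrite lerD2l ler_wpM2l// (le_trans _ (vK N))//.
by apply: ler_sum => n _; rewrite ler_wpM2r ?exprn_ge0.
Qed.

(** The successive differences of [(n + 1) ^ 2] are [2 n + 3], [2] and [0], so three rounds of
    [weighted_geometric_bound] end at the zero sequence. *)
Lemma sqr_geometric_bound (r : R) : 0 <= r < 1 ->
  exists K, forall N, \sum_(0 <= n < N) (n%:R + 1) ^+ 2 * r ^+ n <= K.
Proof.
move=> r01; have b0 N : \sum_(0 <= n < N) (0 : R) * r ^+ n <= 0.
  by rewrite big1// => n _; rewrite mul0r.
have b1 := @weighted_geometric_bound (fun=> 2) (fun=> 0) r 0 r01
  (fun=> ler0n _ _) (fun n => ltac:(by rewrite subrr)) b0.
have b2 := @weighted_geometric_bound (fun n => 2 * n%:R + 3) (fun=> 2) r _ r01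
  (fun n => ltac:(by rewrite addr_ge0// mulr_ge0))
  (fun n => ltac:(by rewrite -natr1; lra)) b1.
eexists; apply: (weighted_geometric_bound r01 _ _ b2) => n; first exact: sqr_ge0.
by rewrite -natr1 le_eqVlt; apply/orP; left; apply/eqP; ring.
Qed.

(** This single majorant serves for a power series, its derivative and its second order
    remainder. *)
Lemma sqr_geometric_cvg (r : R) : 0 <= r < 1 ->
  cvgn (series (fun n => (n%:R + 1) ^+ 2 * r ^+ n)).
Proof.
move=> r01; have [K hK] := sqr_geometric_bound r01.
apply: cvg_series_bounded_sum hK => n.
by have /andP[r0 _] := r01; rewrite mulr_ge0 ?sqr_ge0 ?exprn_ge0.
Qed.

Definition bounded_coef (A : R) a := forall n, cabs (a n) <= A.

Lemma bounded_coef_ge0 A a : bounded_coef A a -> 0 <= A.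
Proof. by move=> /(_ 0%N); apply: le_trans; exact: cabs_ge0. Qed.

Lemma pseries_cvg A a z : bounded_coef A a -> inD z ->
  pseries_to a z (csum (fun n => a n * z ^+ n)).
Proof.
rewrite inDE => bA z1; have A0 := bounded_coef_ge0 bA.
apply: (@cvg_csum _ _ (fun n => A * ((n%:R + 1) ^+ 2 * cabs z ^+ n))) => [n|].
  rewrite cabsM cabsX ler_pM ?cabs_ge0 ?exprn_ge0 ?cabs_ge0//.
  rewrite ler_peMl ?exprn_ge0 ?cabs_ge0// exprn_ege1//.
  by rewrite lerDr.
by apply: is_cvg_seriesZ; apply: sqr_geometric_cvg; rewrite cabs_ge0.
Qed.

Lemma pseries_deriv_cvg A a z : bounded_coef A a -> inD z ->
  series (fun n => n%:R * a n * z ^+ n.-1 : C^o) @ \oo -->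
    (csum (fun n => n%:R * a n * z ^+ n.-1) : C^o).
Proof.
move=> bA; rewrite inDE => z1; have A0 := bounded_coef_ge0 bA.
(* A radius between [cabs z] and [1] that is positive even for [z = 0], since the majorant divides
   by it. *)
pose r := (1 + cabs z) / 2.
have z0 := cabs_ge0 z; have r0 : 0 < r by rewrite /r; lra.
have r1 : r < 1 by rewrite /r; lra.
have zr : cabs z <= r by rewrite /r; lra.
apply: (@cvg_csum _ _ (fun n => A / r * ((n%:R + 1) ^+ 2 * r ^+ n))) => [n|]; last first.
  by apply: is_cvg_seriesZ; apply: sqr_geometric_cvg; rewrite ltW.
case: n => [|n]; first by rewrite !mul0r cabs0 !mulr_ge0 ?invr_ge0 ?sqr_ge0 ?exprn_ge0// ltW.
rewrite !cabsM cabs_nat cabsX /= (exprS r).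
rewrite (_ : A / r * _ = (n.+1%:R + 1) ^+ 2 * A * r ^+ n); last by field; rewrite gt_eqF.
rewrite ler_pM ?mulr_ge0 ?cabs_ge0 ?exprn_ge0//; last by rewrite lerXn2r ?nnegrE// ltW.
by rewrite ler_pM ?cabs_ge0//; have : 0 <= n.+1%:R :> R by []; nra.
Qed.

(** The remainders satisfy [E_(n+1) = (z + h) E_n + n h ^ 2 z ^ (n - 1)], and
    [n ^ 2 + n <= (n + 1) ^ 2] closes the induction. The factor [r ^ 2] on the left avoids the
    exponent [n - 2] on the right. *)
Lemma taylor_monomial_bound (r : R) z h n : 0 < r -> cabs z <= r -> cabs (z + h) <= r ->
  r ^+ 2 * cabs ((z + h) ^+ n - z ^+ n - n%:R * h * z ^+ n.-1) <=
  n%:R ^+ 2 * cabs h ^+ 2 * r ^+ n.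
Proof.
move=> r0 zr zhr; elim: n => [|n IH].
  by rewrite !expr0 subrr !mul0r subrr cabs0 mulr0 (expr0n R 2) !mul0r.
set E := (z + h) ^+ n - z ^+ n - _ in IH *.
have -> : (z + h) ^+ n.+1 - z ^+ n.+1 - n.+1%:R * h * z ^+ n =
    (z + h) * E + n%:R * h ^+ 2 * z ^+ n.-1.
  rewrite /E -natr1; case: n {IH E} => [|n]; first by rewrite /= !expr0 !expr1; ring.
  by rewrite /= !exprS; ring.
have h0 := cabs_ge0 h; have E0 := cabs_ge0 E; have zh0 := cabs_ge0 (z + h).
have rn0 : 0 <= r ^+ n by rewrite exprn_ge0// ltW.
have h1 : r ^+ 2 * cabs ((z + h) * E) <= n%:R ^+ 2 * cabs h ^+ 2 * r ^+ n * r.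
  rewrite cabsM mulrCA mulrC; apply: ler_pM => //.
  by rewrite mulr_ge0 ?sqr_ge0.
have h2 : r ^+ 2 * cabs (n%:R * h ^+ 2 * z ^+ n.-1) <= n%:R * cabs h ^+ 2 * r ^+ n * r.
  rewrite !cabsM cabs_nat !cabsX; case: n {IH E E0 h1 rn0} => [|n]; first by rewrite !mul0r mulr0.
  rewrite (_ : _ * _ = n.+1%:R * cabs h ^+ 2 * r ^+ 2 * cabs z ^+ n); last by rewrite /=; ring.
  rewrite (_ : _ * r = n.+1%:R * cabs h ^+ 2 * r ^+ 2 * r ^+ n); last by rewrite (exprS r); ring.
  rewrite ler_wpM2l ?mulr_ge0 ?sqr_ge0 ?(ltW r0)//.
  by rewrite lerXn2r ?nnegrE ?cabs_ge0 ?(ltW r0).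
rewrite (le_trans (ler_wpM2l (sqr_ge0 r) (cabsD _ _)))// mulrDr.
rewrite (le_trans (lerD h1 h2))// -subr_ge0.
rewrite (_ : _ - _ = (n%:R + 1) * (cabs h ^+ 2 * r ^+ n * r)); last first.
  by rewrite -natr1 (exprS r n); ring.
by rewrite mulr_ge0 ?addr_ge0// !mulr_ge0 ?sqr_ge0 ?(ltW r0).
Qed.

End PowerSeries.

(** * Derivatives and uniqueness of power series *)

Section PowerSeriesDeriv.
Variable R : realType.
Local Notation C := R[i].
Implicit Types (z w h : C) (a : nat -> C).

Lemma ccvgB (f g : nat -> C) (l m : C) :
  f @ \oo --> (l : C^o) -> g @ \oo --> (m : C^o) ->
  (fun n => f n - g n) @ \oo --> (l - m : C^o).
Proof.
move=> /ccvgP fl /ccvgP gm; apply: (@ccvg_le _ _ _ _ _ _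
    (fun n => cabs (f n - l) + cabs (g n - m))); last first.
  by rewrite -[X in _ --> X](addr0 0); exact: cvgD fl gm.
apply: nearW => x; rewrite (_ : _ - _ = (f x - l) - (g x - m)); last by ring.
by rewrite (le_trans (cabsD _ _))// cabsN.
Qed.

Lemma ccvgMl (c : C) (f : nat -> C) (l : C) :
  f @ \oo --> (l : C^o) -> (fun n => c * f n) @ \oo --> (c * l : C^o).
Proof.
move=> /ccvgP fl; apply: (@ccvg_le _ _ _ _ _ _ (fun n => cabs c * cabs (f n - l))); last first.
  by rewrite -[X in _ --> X](mulr0 (cabs c)); exact: cvgMl_tmp fl.
by apply: nearW => x; rewrite -mulrBr cabsM.
Qed.

Lemma ccvg_ext (f g : nat -> C) (l : C) : (forall n, f n = g n) ->
  f @ \oo --> (l : C^o) -> g @ \oo --> (l : C^o).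
Proof. by move=> /funext ->. Qed.

Lemma ccvg_cst (c : C) : (fun _ : nat => c) @ \oo --> (c : C^o).
Proof. by apply/ccvgP; rewrite subrr cabs0; exact: cvg_cst. Qed.

Lemma ccvg_shiftS (f : nat -> C) (l : C) :
  (fun n => f n.+1) @ \oo --> (l : C^o) <-> f @ \oo --> (l : C^o).
Proof. by rewrite -(@cvg_shiftS C^o f). Qed.

Lemma lim_series_mull (k : R) (u : nat -> R) : cvgn (series u) ->
  limn (series (fun n => k * u n)) = k * limn (series u).
Proof. exact: lim_seriesZ. Qed.

Lemma is_cvg_series_mull (k : R) (u : nat -> R) : cvgn (series u) ->
  cvgn (series (fun n => k * u n)).
Proof. exact: is_cvg_seriesZ. Qed.

Lemma cabs_nbhs0 : cabs h @[h --> (0 : C^o)] --> (0 : R).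
Proof.
have /ccvgP : (fun h : C => h) @ (0 : C^o) --> (0 : C^o) by exact: cvg_id.
by under eq_fun do rewrite subr0.
Qed.

Lemma pseries_taylor_bound A a f z : bounded_coef A a ->
  (forall w, inD w -> pseries_to a w (f w)) -> inD z ->
  exists B d : R, [/\ 0 < d, 0 <= B & forall h, cabs h < d ->
    cabs (f (z + h) - f z - h * csum (fun n => n%:R * a n * z ^+ n.-1)) <=
    B * cabs h ^+ 2].
Proof.
move=> bA fa zD; have := zD; rewrite inDE => z1; have A0 := bounded_coef_ge0 bA.
pose r := (1 + cabs z) / 2.
have z0 := cabs_ge0 z; have r0 : 0 < r by rewrite /r; lra.
have r1 : r < 1 by rewrite /r; lra.
have zr : cabs z <= r by rewrite /r; lra.
have cS : cvgn (series (fun n => (n%:R + 1) ^+ 2 * r ^+ n)).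
  by apply: sqr_geometric_cvg; rewrite ltW.
have S0 : 0 <= limn (series (fun n => (n%:R + 1) ^+ 2 * r ^+ n)).
  apply: limr_ge => //; apply: nearW => n; apply: sumr_ge0 => i _.
  by rewrite mulr_ge0 ?sqr_ge0 ?exprn_ge0// ltW.
(* For [cabs h < (1 - cabs z) / 2] the point [z + h] stays within radius [r], so the monomial bounds
   can be summed. *)
exists (A / r ^+ 2 * limn (series (fun n => (n%:R + 1) ^+ 2 * r ^+ n))), ((1 - cabs z) / 2).
split; [by lra|by rewrite !mulr_ge0 ?invr_ge0 ?sqr_ge0|move=> h hd].
have zhr : cabs (z + h) <= r by rewrite (le_trans (cabsD _ _))// /r; lra.
have c1 : pseries_to a (z + h) (f (z + h)) by apply: fa; rewrite inDE (le_lt_trans zhr).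
have c2 := fa _ zD; have c3 := ccvgMl (c := h) (pseries_deriv_cvg bA zD).
have c4 := ccvgB (ccvgB c1 c2) c3.
rewrite mulrAC -[X in _ <= X](_ : limn (series
    (fun n => A / r ^+ 2 * cabs h ^+ 2 * ((n%:R + 1) ^+ 2 * r ^+ n))) = _); last first.
  by rewrite lim_series_mull.
apply: (@cvg_series_le _ (fun n => a n * ((z + h) ^+ n - z ^+ n - n%:R * h * z ^+ n.-1))).
- rewrite [X in X @ _](_ : _ = (fun n => (series (fun m => a m * (z + h) ^+ m : C^o) n -
    series (fun m => a m * z ^+ m : C^o) n) -
    h * series (fun m => m%:R * a m * z ^+ m.-1 : C^o) n)) //.
  apply/funext => n; rewrite /series /= mulr_sumr -!sumrB.
  by apply: eq_bigr => i _; ring.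
- move=> n; rewrite cabsM [leRHS](_ : _ = A * ((n%:R + 1) ^+ 2 * cabs h ^+ 2 * r ^+ n / r ^+ 2)); last first.
    by move: (r ^- 2) => q; ring.
  rewrite ler_pM ?cabs_ge0// ler_pdivlMr ?exprn_gt0// mulrC.
  rewrite (le_trans (taylor_monomial_bound _ r0 zr zhr))//.
  rewrite ler_wpM2r ?exprn_ge0 ?(ltW r0)// ler_wpM2r ?sqr_ge0//.
  by rewrite lerXn2r ?nnegrE ?addr_ge0// lerDl.
- exact: is_cvg_series_mull.
Qed.

(** The remainder is [O(|h| ^ 2)], hence the difference quotient misses the termwise derivative by
    [O(|h|)]. *)
Lemma cderiv_pseries A a f z : bounded_coef A a ->
  (forall w, inD w -> pseries_to a w (f w)) -> inD z ->
  cderiv f z = csum (fun n => n%:R * a n * z ^+ n.-1).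
Proof.
move=> bA fa zD; have [B [d [d0 B0 hB]]] := pseries_taylor_bound bA fa zD.
rewrite /cderiv /derive1; apply: (@cvg_lim C^o (@norm_hausdorff C C^o)).
apply: (@ccvg_le _ _ _ _ _ _ (fun h => B * cabs h)); last first.
  rewrite -[X in _ --> X](mulr0 B); apply: cvgMl_tmp.
  by apply: cvg_within_filter; exact: cabs_nbhs0.
have nd : \forall h \near (0 : C^o), cabs h < d.
  have /cvgrPdist_lt /(_ d d0) := cabs_nbhs0; apply: filterS => h.
  by rewrite sub0r normrN ger0_norm ?cabs_ge0.
rewrite near_withinE; apply: filterS nd => h hd h0.
have ch0 : 0 < cabs h by rewrite lt_neqAle cabs_ge0 eq_sym cabs_eq0 h0.
have := hB h hd; rewrite (addrC z h) => hb.
rewrite -(ler_pM2l ch0) -cabsM mulrCA -expr2; apply: le_trans hb.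
rewrite le_eqVlt; apply/orP; left; apply/eqP; congr cabs.
by rewrite mulrBr /GRing.scale /= mulrA divff ?mul1r.
Qed.

(** Small positive reals [z] show that the constant coefficient vanishes; dividing by [z] then
    shifts the sequence. The hypothesis leaves out [z = 0] so that it survives the division. *)
Lemma pseries_eq0 (A : R) d : bounded_coef A d ->
  (forall z, inD z -> z != 0 -> pseries_to d z 0) -> forall n, d n = 0.
Proof.
have step e : bounded_coef A e ->
    (forall z, inD z -> z != 0 -> pseries_to e z 0) -> e 0%N = 0.
  move=> bA e0; have A0 := bounded_coef_ge0 bA.
  have h01 : 0 <= (2^-1 : R) < 1 by apply/andP; split; lra.
  have cS := sqr_geometric_cvg h01.
  (* At [x] the series without its constant term sums to [- e 0], and each of its terms carries a
     factor [x]. *)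
  have key (x : R) : 0 < x -> x <= 2^-1 -> cabs (e 0%N) <= 2 * A * x * limn (series (fun n => (n%:R + 1) ^+ 2 * (2^-1 : R) ^+ n)).
    move=> x0 x2; have cx : cabs x%:C = x by rewrite cabs_real gtr0_norm.
    have xD : inD x%:C by rewrite inDE cx; lra.
    have x0' : x%:C != 0 by rewrite -cabs_eq0 cx gt_eqF.
    rewrite -cabsN -sub0r.
    rewrite -[X in _ <= X](_ : limn (series (fun n => 2 * A * x * ((n%:R + 1) ^+ 2 * (2^-1 : R) ^+ n))) = _); last first.
      by rewrite lim_series_mull.
    apply: (@cvg_series_le _ (fun n => if n is m.+1 then e n * x%:C ^+ n else 0)).
    - apply/ccvg_shiftS.
      have h1 := (ccvg_shiftS _ _).2 (e0 _ xD x0').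
      apply: ccvg_ext (ccvgB h1 (@ccvg_cst (e 0%N))) => n; rewrite /series /= !big_nat_recl//= expr0 mulr1.
      by rewrite add0r addrAC subrr add0r.
    - case=> [|n]; first by rewrite cabs0 !mulr_ge0// ltW.
      rewrite cabsM cabsX cx exprS.
      rewrite [leRHS](_ : _ = A * (x * ((n.+1%:R + 1) ^+ 2 * 2^-1 ^+ n))); last first.
        by rewrite (exprS 2^-1); field.
      rewrite ler_pM ?cabs_ge0 ?mulr_ge0 ?exprn_ge0 ?(ltW x0)// ler_wpM2l ?(ltW x0)//.
      rewrite -[leLHS]mul1r ler_pM ?exprn_ge0 ?(ltW x0)//.
        by rewrite exprn_ege1// lerDr.
      by rewrite lerXn2r ?nnegrE ?(ltW x0).
    - exact: is_cvg_series_mull.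
  set K := limn _ in key.
  apply/eqP; rewrite -cabs_eq0 eq_le cabs_ge0 andbT; apply/ler_addgt0Pl => eps eps0.
  (* Small enough for the bound of [key] to fall below [eps]; the absolute value and the [+ 1] keep
     the denominator positive. *)
  rewrite addr0; pose x := Num.min 2^-1 (eps / (2 * A * `|K| + 1)).
  have p0 : 0 < 2 * A * `|K| + 1 by rewrite ltr_wpDl// !mulr_ge0.
  have x0 : 0 < x by rewrite lt_min divr_gt0// andbT.
  have x2 : x <= 2^-1 by rewrite ge_min lexx.
  have xe : x * (2 * A * `|K| + 1) <= eps by rewrite -ler_pdivlMr// ge_min lexx orbT.
  apply: le_trans (key x x0 x2) _; apply: le_trans xe.
  have : 2 * A * x * K <= 2 * A * x * `|K| by rewrite ler_wpM2l ?ler_norm// !mulr_ge0// ltW.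
  lra.
move=> bA d0 n; elim: n d bA d0 => [|n IH] d bA d0; first exact: step.
have d00 := step _ bA d0.
apply: (IH (fun n => d n.+1)) => [k|z zD z0]; first exact: bA.
have := ccvgMl (c := z^-1) ((ccvg_shiftS _ _).2 (d0 _ zD z0)).
rewrite mulr0; apply: ccvg_ext => k.
rewrite /series /= big_nat_recl// d00 mul0r add0r mulr_sumr.
by apply: eq_bigr => i _; rewrite exprS mulrCA mulKf.
Qed.

Lemma pseries_unique A B a b : bounded_coef A a -> bounded_coef B b ->
  (forall z, inD z -> exists l, pseries_to a z l /\ pseries_to b z l) -> a = b.
Proof.
move=> bA bB ab; apply/funext => n; apply/eqP; rewrite -subr_eq0; apply/eqP.
apply: (@pseries_eq0 (A + B) (fun n => a n - b n)) => [k|z zD _].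
  by rewrite (le_trans (cabsD _ _))// cabsN lerD ?bA ?bB.
have [l [al bl]] := ab z zD; have := ccvgB al bl; rewrite subrr.
apply: ccvg_ext => k; rewrite /series /= -sumrB.
by apply: eq_bigr => i _; rewrite mulrBl.
Qed.

End PowerSeriesDeriv.

(** * The Littlewood-Paley pairing *)

Section ComplexIntegral.
Variable R : realType.
Local Notation C := R[i].
Local Notation leb := (@lebesgue_measure R).
Local Notation mu := (leb \x leb)%E.
Local Notation RR := (measurableTypeR R * measurableTypeR R)%type.
Local Notation D := (@disc_set R : set RR).
Let mD : measurable D := @measurable_disc R.
Local Hint Resolve mD : core.

(** Integrability of both parts travels with the value, so that linear combinations and sums need no
    separate integrability argument. *)
Definition has_cintegral (G : RR -> C) (v : C) :=
  [/\ mu.-integrable D (EFin \o (fun p => complex.Re (G p))),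
      mu.-integrable D (EFin \o (fun p => complex.Im (G p))),
      \int[mu]_(p in D) complex.Re (G p) = complex.Re v &
      \int[mu]_(p in D) complex.Im (G p) = complex.Im v].

Lemma complexReM (x y : C) : complex.Re (x * y) =
  complex.Re x * complex.Re y - complex.Im x * complex.Im y.
Proof. by case: x; case: y. Qed.

Lemma complexImM (x y : C) : complex.Im (x * y) =
  complex.Re x * complex.Im y + complex.Im x * complex.Re y.
Proof. by case: x => a b; case: y. Qed.

Lemma has_cintegral0 : has_cintegral (fun=> 0) 0.
Proof.
have i0 : mu.-integrable D (EFin \o (fun=> 0 : R)).
  exact: regular_integrable (regular_cst 0).
by split=> //=; rewrite integral_disc_cst mul0r.
Qed.

Lemma has_cintegralD G H v w : has_cintegral G v -> has_cintegral H w ->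
  has_cintegral (fun p => G p + H p) (v + w).
Proof.
move=> [g1 g2 g3 g4] [h1 h2 h3 h4].
have e1 : (fun p => complex.Re (G p + H p)) = (fun p => complex.Re (G p) + complex.Re (H p)).
  by apply/funext => p; rewrite raddfD.
have e2 : (fun p => complex.Im (G p + H p)) = (fun p => complex.Im (G p) + complex.Im (H p)).
  by apply/funext => p; rewrite raddfD.
split; rewrite ?e1 ?e2.
- exact: (integrableD mD g1 h1).
- exact: (integrableD mD g2 h2).
- by rewrite RintegralD// g3 h3 raddfD.
- by rewrite RintegralD// g4 h4 raddfD.
Qed.

Lemma has_cintegralZ c G v : has_cintegral G v ->
  has_cintegral (fun p => c * G p) (c * v).
Proof.
move=> [g1 g2 g3 g4].
have iZ k (u : RR -> R) : mu.-integrable D (EFin \o u) ->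
    mu.-integrable D (EFin \o (fun p => k * u p)).
  by move=> iu; have := integrableZl mD k iu; apply: eq_integrable => // p _.
have e1 : (fun p => complex.Re (c * G p)) =
    (fun p => complex.Re c * complex.Re (G p) - complex.Im c * complex.Im (G p)).
  by apply/funext => p; rewrite complexReM.
have e2 : (fun p => complex.Im (c * G p)) =
    (fun p => complex.Re c * complex.Im (G p) + complex.Im c * complex.Re (G p)).
  by apply/funext => p; rewrite complexImM.
split; rewrite ?e1 ?e2.
- exact: (integrableB mD (iZ _ _ g1) (iZ _ _ g2)).
- exact: (integrableD mD (iZ _ _ g2) (iZ _ _ g1)).
- rewrite RintegralB//; [|exact: iZ..].
  by rewrite !RintegralZl// g3 g4 complexReM.
- rewrite RintegralD//; [|exact: iZ..].
  by rewrite !RintegralZl// g3 g4 complexImM.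
Qed.

Lemma has_cintegral_sum (I : Type) (r : seq I) (G : I -> RR -> C) (v : I -> C) :
  (forall i, has_cintegral (G i) (v i)) ->
  has_cintegral (fun p => \sum_(i <- r) G i p) (\sum_(i <- r) v i).
Proof.
move=> Gv; elim: r => [|i r IH].
  rewrite big_nil; under [X in has_cintegral X]eq_fun do rewrite big_nil.
  exact: has_cintegral0.
rewrite big_cons; under [X in has_cintegral X]eq_fun do rewrite big_cons.
exact: has_cintegralD.
Qed.

Lemma has_cintegral_monom m k :
  has_cintegral (fun p : RR => monom m k p * (logw2 p)%:C)
                ((m == k)%:R * (pi / m.+1%:R ^+ 2))%:C.
Proof.
have [h1 h2] := integral_ReIm_monom_logw2 R m k.
have [i1 i2] := integrable_monom_logw2 R m k.
have e1 : (fun p : RR => complex.Re (monom m k p * (logw2 p)%:C)) =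
    (fun p : RR => complex.Re (monom m k p) * logw2 p).
  by apply/funext => p; rewrite complexReM /= mulr0 subr0.
have e2 : (fun p : RR => complex.Im (monom m k p * (logw2 p)%:C)) =
    (fun p : RR => complex.Im (monom m k p) * logw2 p).
  by apply/funext => p; rewrite complexImM /= mulr0 add0r.
by split; rewrite ?e1 ?e2.
Qed.

(** After expansion, orthogonality of the monomials leaves the diagonal terms only. *)
Lemma has_cintegral_bipoly N (al be : nat -> C) :
  has_cintegral
    (fun p => (\sum_(0 <= m < N) al m * (p.1 +i* p.2) ^+ m) *
              (\sum_(0 <= k < N) be k * (p.1 -i* p.2) ^+ k) * (logw2 p)%:C)
    (\sum_(0 <= m < N) al m * be m * (pi / m.+1%:R ^+ 2)%:C).
Proof.
have h := has_cintegral_sum (index_iota 0 N) (fun m => has_cintegral_sum (index_iota 0 N)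
  (fun k => has_cintegralZ (al m * be k) (has_cintegral_monom m k))).
move: h; congr has_cintegral.
  apply/funext => p; rewrite !mulr_suml; apply: eq_bigr => m _.
  rewrite mulr_sumr mulr_suml; apply: eq_bigr => k _.
  by rewrite /monom; ring.
apply: eq_big_nat => m /andP[_ mN].
rewrite (bigD1_seq m) ?iota_uniq ?mem_index_iota//= eqxx mul1r big1 ?addr0// => k km.
by rewrite eq_sym (negbTE km) mul0r mulr0.
Qed.

(** The convergence of [v_] is part of the conclusion: this is how the pairing will acquire its
    series expansion. *)
Lemma has_cintegral_dominated (G_ : nat -> RR -> C) (v_ : nat -> C) (G : RR -> C)
    (g : RR -> \bar R) :
  (forall n, has_cintegral (G_ n) (v_ n)) ->
  (forall p, D p -> (fun n => G_ n p) @ \oo --> (G p : C^o)) ->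
  mu.-integrable D g ->
  (forall n p, D p -> ((cabs (G_ n p))%:E <= g p)%E) ->
  exists v, has_cintegral G v /\ v_ @ \oo --> (v : C^o).
Proof.
move=> hG cG ig Gg.
have cR p (Dp : D p) : complex.Re (G_ n p) @[n --> \oo] --> complex.Re (G p) /\
    complex.Im (G_ n p) @[n --> \oo] --> complex.Im (G p).
  by apply/ccvg_ReIm; exact: cG.
have mRe n : measurable_fun D (fun p => complex.Re (G_ n p)).
  by have [/integrableP[/measurable_EFinP]] := hG n.
have mIm n : measurable_fun D (fun p => complex.Im (G_ n p)).
  by have [_ /integrableP[/measurable_EFinP]] := hG n.
have mGR : measurable_fun D (fun p => complex.Re (G p)).
  by apply: (measurable_fun_cvg mRe) => p Dp; exact: (cR p Dp).1.
have mGI : measurable_fun D (fun p => complex.Im (G p)).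
  by apply: (measurable_fun_cvg mIm) => p Dp; exact: (cR p Dp).2.
have [iR vR] : mu.-integrable D (EFin \o (fun p => complex.Re (G p))) /\
    \int[mu]_(p in D) complex.Re (G_ n p) @[n --> \oo] --> \int[mu]_(p in D) complex.Re (G p).
  apply: (Rintegral_dominated_cvg mRe mGR _ ig).
    by apply: aeW => p Dp; exact: (cR p Dp).1.
  apply: aeW => p n Dp; apply: le_trans (Gg n p Dp).
  by rewrite lee_fin; exact: Re_le_cabs.
have [iI vI] : mu.-integrable D (EFin \o (fun p => complex.Im (G p))) /\
    \int[mu]_(p in D) complex.Im (G_ n p) @[n --> \oo] --> \int[mu]_(p in D) complex.Im (G p).
  apply: (Rintegral_dominated_cvg mIm mGI _ ig).
    by apply: aeW => p Dp; exact: (cR p Dp).2.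
  apply: aeW => p n Dp; apply: le_trans (Gg n p Dp).
  by rewrite lee_fin; exact: Im_le_cabs.
exists ((\int[mu]_(p in D) complex.Re (G p)) +i* (\int[mu]_(p in D) complex.Im (G p))).
split; first by split.
apply/ccvg_ReIm; split=> /=.
  rewrite (_ : (fun n => _) = (fun n => \int[mu]_(p in D) complex.Re (G_ n p))) //.
  by apply/funext => n; have [_ _ -> _] := hG n.
rewrite (_ : (fun n => _) = (fun n => \int[mu]_(p in D) complex.Im (G_ n p))) //.
by apply/funext => n; have [_ _ _ ->] := hG n.
Qed.

Lemma disc_integral_has (F : C -> C) v :
  has_cintegral (fun p => F (p.1 +i* p.2)) v -> disc_integral F = (pi^-1)%:C * v.
Proof.
move=> [_ _ h1 h2]; rewrite /disc_integral h1 h2.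
by apply/eqP; rewrite eq_complex; case: v {h1 h2} => a b /=; apply/andP; split; apply/eqP; ring.
Qed.

End ComplexIntegral.

(** * Termwise integration of the pairing *)

Section Duality.
Variable R : realType.
Local Notation C := R[i].
Local Notation leb := (@lebesgue_measure R).
Local Notation mu := (leb \x leb)%E.
Local Notation RR := (measurableTypeR R * measurableTypeR R)%type.
Local Notation D := (@disc_set R : set RR).
Let mD : measurable D := @measurable_disc R.
Local Hint Resolve mD : core.

Lemma ccvgM (f g : nat -> C) (l m : C) :
  f @ \oo --> (l : C^o) -> g @ \oo --> (m : C^o) ->
  (fun n => f n * g n) @ \oo --> (l * m : C^o).
Proof.
move=> /ccvg_ReIm[f1 f2] /ccvg_ReIm[g1 g2]; apply/ccvg_ReIm; split.
  under eq_fun do rewrite complexReM.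
  by rewrite complexReM; apply: cvgB; exact: cvgM.
under eq_fun do rewrite complexImM.
by rewrite complexImM; apply: cvgD; exact: cvgM.
Qed.

Lemma sum_inv_sqr_le N : \sum_(0 <= n < N) (n.+1%:R ^+ 2)^-1 <= 2 :> R.
Proof.
(* The sharper bound [2 - 1 / (N + 1)] is the one that passes through the induction, as for a
   telescoping sum. *)
suff h : \sum_(0 <= n < N.+1) (n.+1%:R ^+ 2)^-1 <= 2 - N.+1%:R^-1 :> R.
  rewrite (le_trans (le_trans _ h))//; last by rewrite gerBl invr_ge0.
  by rewrite big_nat_recr//= lerDl invr_ge0 sqr_ge0.
elim: N => [|N IH]; first by rewrite big_nat1 expr1n invr1; lra.
rewrite big_nat_recr//= (le_trans (lerD IH (lexx _)))//.
have n0 : 0 < N.+1%:R :> R by rewrite ltr0n.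
rewrite -[N.+2%:R]natr1; set x := N.+1%:R in n0 *.
have x1 : 0 < x + 1 by rewrite addr_gt0.
rewrite -subr_ge0 (_ : _ - _ = (x * (x + 1) ^+ 2)^-1); last by field; rewrite !gt_eqF.
by rewrite invr_ge0 mulr_ge0 ?sqr_ge0 ?ltW.
Qed.

Lemma sqsummable_bound (a : nat -> C) : sqsummable a ->
  exists K, forall N, \sum_(0 <= n < N) csqn (a n) <= K.
Proof.
move=> sa; exists (limn (series (fun m => csqn (a m)))) => N.
apply: nondecreasing_cvgn_le => //; apply: nondecreasing_series => n _ _.
exact: csqn_ge0.
Qed.

Lemma sqsummable_bounded_coef (a : nat -> C) : sqsummable a -> exists A, bounded_coef A a.
Proof.
move=> /sqsummable_bound[K hK]; exists (K + 1) => n.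
have := hK n.+1; rewrite big_nat_recr//= csqnE.
have : 0 <= \sum_(0 <= i < n) csqn (a i) by apply: sumr_ge0 => i _; exact: csqn_ge0.
have := cabs_ge0 (a n); nra.
Qed.

(** Termwise [x * y <= x ^ 2 + y ^ 2]; the inverse squares add up to at most [2]. *)
Lemma sum_sqsummable_div_le (a : nat -> C) : sqsummable a ->
  exists K, forall N, \sum_(0 <= n < N) cabs (a n.+1) / n.+1%:R <= K.
Proof.
move=> /sqsummable_bound[K hK]; exists (K + 2) => N.
apply: (@le_trans _ _ (\sum_(0 <= n < N) (csqn (a n.+1) + (n.+1%:R ^+ 2)^-1))).
  apply: ler_sum => n _; rewrite csqnE -exprVn.
  by move: (cabs _) (_^-1) => x y; nra.
rewrite big_split lerD ?sum_inv_sqr_le// (le_trans _ (hK N.+1))//.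
by rewrite [leRHS]big_nat_recl// lerDr csqn_ge0.
Qed.

Lemma cabs_rho (p : RR) : cabs ((p.1 : R) +i* (p.2 : R)) ^+ 2 = rho p.
Proof. by rewrite -csqnE. Qed.

(** The available moments concern powers of [rho = |w| ^ 2], so odd powers of [|w|] are rounded down
    to even ones. *)
Lemma expr_le_half (x : R) m : 0 <= x <= 1 -> x ^+ m <= (x ^+ 2) ^+ m./2.
Proof.
move=> /andP[x0 x1]; rewrite -exprM mul2n -{1}(odd_double_half m).
by rewrite exprD ler_piMl ?exprn_ge0// exprn_ile1.
Qed.

(** On the disc it dominates [|f'(w)| log (1 / |w| ^ 2)] and all partial sums of [f'] times the
    weight. With extended values the sum of nonnegative terms exists without a convergence
    argument. *)
Definition majorant (a : nat -> C) (p : RR) : \bar R :=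
  (\sum_(m <oo) (m.+1%:R * cabs (a m.+1) * (rho p ^+ m./2 * logw2 p))%:E)%E.

Lemma majorant_term_ge0 (a : nat -> C) m p : D p ->
  0 <= m.+1%:R * cabs (a m.+1) * (rho p ^+ m./2 * logw2 p).
Proof.
by move=> Dp; rewrite !mulr_ge0 ?cabs_ge0 ?exprn_ge0 ?rho_ge0// logw2_ge0.
Qed.

Lemma integrable_majorant (a : nat -> C) : sqsummable a ->
  mu.-integrable D (majorant a).
Proof.
move=> /sum_sqsummable_div_le[K hK].
have mt m : measurable_fun D
    (fun p : RR => (m.+1%:R * cabs (a m.+1) * (rho p ^+ m./2 * logw2 p))%:E).
  apply/measurable_EFinP; apply: measurable_funTS.
  apply: measurable_funM => //; apply: measurable_funM; last exact: measurable_logw2.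
  by apply: measurable_funX; exact: measurable_rhoR.
have g0 p : D p -> (0 <= majorant a p)%E.
  by move=> Dp; apply: nneseries_ge0 => m _ _; rewrite lee_fin majorant_term_ge0.
have mg : measurable_fun D (majorant a).
  apply: (@emeasurable_fun_cvg _ _ _ _ (fun n p =>
    (\sum_(0 <= m < n) (m.+1%:R * cabs (a m.+1) * (rho p ^+ m./2 * logw2 p))%:E)%E)).
    by move=> n; apply: emeasurable_sum => m; exact: mt.
  move=> p Dp; apply: is_cvg_nneseries => m _ _.
  by rewrite lee_fin majorant_term_ge0.
apply/integrableP; split=> //.
apply: (@le_lt_trans _ _ (\int[mu]_(p in D) majorant a p)%E).
  rewrite le_eqVlt; apply/orP; left; apply/eqP; apply: eq_integral => p.
  by rewrite inE => Dp; rewrite gee0_abs// g0.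
rewrite integral_nneseries//; last by move=> m p Dp; rewrite lee_fin majorant_term_ge0.
(* The [4] comes from [m + 1 <= 2 (m./2 + 1)]: the [m]-th integral is at most
   [4 pi |a_(m+1)| / (m + 1)]. *)
apply: (@le_lt_trans _ _ (4 * pi * K)%:E); last exact: ltry.
apply: lime_le.
  apply: is_cvg_nneseries => m _ _; apply: integral_ge0 => p Dp.
  by rewrite lee_fin majorant_term_ge0.
apply: nearW => N.
apply: (@le_trans _ _ (\sum_(0 <= m < N) (4 * pi * (cabs (a m.+1) / m.+1%:R))%:E)%E); last first.
  by rewrite sumEFin lee_fin -mulr_sumr ler_wpM2l ?hK// mulr_ge0 ?pi_ge0.
apply: lee_sum => m _.
have m0 : 0 <= m.+1%:R * cabs (a m.+1) by rewrite mulr_ge0 ?cabs_ge0.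
rewrite (_ : (\int[mu]_(p in D) _)%E = ((m.+1%:R * cabs (a m.+1))%:E *
    \int[mu]_(p in D) (rho p ^+ m./2 * logw2 p)%:E)%E); last first.
  rewrite -ge0_integralZl//.
  - apply/measurable_EFinP; apply: measurable_funTS.
    apply: measurable_funM; last exact: measurable_logw2.
    by apply: measurable_funX; exact: measurable_rhoR.
  - by move=> p Dp; rewrite lee_fin mulr_ge0 ?exprn_ge0 ?rho_ge0// logw2_ge0.
apply: (@le_trans _ _ ((m.+1%:R * cabs (a m.+1))%:E * (pi / (m./2).+1%:R ^+ 2)%:E)%E).
  by rewrite lee_wpmul2l ?lee_fin// integral_rhoX_logw2_le.
rewrite -EFinM lee_fin.
have n0 : 0 < m.+1%:R :> R by rewrite ltr0n.
have k0 : 0 < (m./2).+1%:R :> R by rewrite ltr0n.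
have hk : m.+1%:R <= 2 * (m./2).+1%:R :> R.
  rewrite -natrM ler_nat mul2n -{1}(odd_double_half m) doubleS.
  by case: (odd m); rewrite ?add0n ?add1n.
rewrite [leLHS](_ : _ = pi * cabs (a m.+1) * (m.+1%:R / (m./2).+1%:R ^+ 2)); last by ring.
rewrite [leRHS](_ : _ = pi * cabs (a m.+1) * (4 / m.+1%:R)); last by ring.
rewrite ler_wpM2l ?mulr_ge0 ?pi_ge0 ?cabs_ge0//.
rewrite ler_pdivrMr ?exprn_gt0// mulrAC ler_pdivlMr//; nra.
Qed.

Lemma pseries_deriv_shift A (a : nat -> C) z : bounded_coef A a -> inD z ->
  (fun n => \sum_(0 <= m < n) m.+1%:R * a m.+1 * z ^+ m) @ \oo -->
    (csum (fun n => n%:R * a n * z ^+ n.-1) : C^o).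
Proof.
move=> bA zD; apply: ccvg_ext ((ccvg_shiftS _ _).2 (pseries_deriv_cvg bA zD)) => n.
by rewrite /series /= big_nat_recl// !mul0r add0r.
Qed.

(** The partial sums of [f'] and [g'] multiply to polynomials in [w] and its conjugate. The two
    derivatives produce [(m + 1) ^ 2], which the moment [pi / (m + 1) ^ 2] cancels, and the outer
    [z] restores the exponent [m + 1]. *)
Lemma littlewood_paley_pairing (a c : nat -> C) (f g : C -> C) (M : R) (z : C) :
  sqsummable a -> (forall w, inD w -> pseries_to a w (f w)) ->
  bounded_coef M c -> (forall w, inD w -> pseries_to c w (g w)) -> inD z ->
  pseries_to (fun m => c m * a m) z (c 0%N * f 0 + z * disc_integral
    (fun w => cderiv f w * cderiv g (z * conjc w) * (logw w)%:C)).
Proof.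
move=> sa fa bM gc zD; have [A bA] := sqsummable_bounded_coef sa.
have M0 := bounded_coef_ge0 bM.
have zw w : inD w -> inD (z * conjc w) /\ cabs (z * conjc w) <= cabs z.
  move: zD; rewrite !inDE cabsM cabs_conj => z1 w1.
  have h : cabs z * cabs w <= cabs z by rewrite ler_piMr ?cabs_ge0// ltW.
  by split=> //; exact: le_lt_trans h z1.
pose G (p : RR) : C := cderiv f (p.1 +i* p.2) * cderiv g (z * (p.1 -i* p.2)) *
  (logw2 p)%:C.
pose al m : C := m.+1%:R * a m.+1.
pose be k : C := k.+1%:R * c k.+1 * z ^+ k.
pose G_ N (p : RR) : C := (\sum_(0 <= m < N) al m * (p.1 +i* p.2) ^+ m) *
  (\sum_(0 <= k < N) be k * (p.1 -i* p.2) ^+ k) * (logw2 p)%:C.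
have cz1 : 0 <= cabs z < 1 by rewrite cabs_ge0 -inDE.
have cK := sqr_geometric_cvg cz1.
set K := limn (series (fun n => (n%:R + 1) ^+ 2 * cabs z ^+ n)).
have hK N : \sum_(0 <= n < N) (n%:R + 1) ^+ 2 * cabs z ^+ n <= K.
  apply: nondecreasing_cvgn_le => //; apply: nondecreasing_series => n _ _.
  by rewrite mulr_ge0 ?sqr_ge0 ?exprn_ge0 ?cabs_ge0.
have K0 : 0 <= K by have := hK 0%N; rewrite big_nil.
have [v [hv cv]] : exists v, has_cintegral G v /\
    (fun N => \sum_(0 <= m < N) al m * be m * (pi / m.+1%:R ^+ 2)%:C) @ \oo --> (v : C^o).
  (* The partial sums of [g'] are at most [M * K] uniformly in [w], as their argument has modulus at
     most [cabs z < 1]; [majorant a] takes care of [f'] and of the weight. *)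
  apply: (@has_cintegral_dominated _ G_ _ G (fun p => ((M * K)%:E * majorant a p)%E)).
  - by move=> N; exact: has_cintegral_bipoly.
  - move=> p Dp; have pD : inD (p.1 +i* p.2) by exact: Dp.
    have [zwD _] := zw _ pD.
    apply: ccvgM (ccvg_cst (c := _)); apply: ccvgM.
      by rewrite (cderiv_pseries bA fa pD); exact: pseries_deriv_shift bA pD.
    rewrite (cderiv_pseries bM gc zwD); apply: ccvg_ext (pseries_deriv_shift bM zwD) => n.
    by apply: eq_bigr => k _; rewrite /be exprMn /=; ring.
  - by apply: integrableZl => //; exact: integrable_majorant.
  - move=> N p Dp; have pD : inD (p.1 +i* p.2) by exact: Dp.
    have [zwD zwz] := zw _ pD.
    have w01 : 0 <= cabs ((p.1 : R) +i* (p.2 : R)) <= 1.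
      by rewrite cabs_ge0 ltW// -inDE.
    have L0 := logw2_ge0 Dp.
    rewrite /G_ !cabsM cabs_real ger0_norm//.
    apply: (@le_trans _ _ (((M * K) * (\sum_(0 <= m < N) m.+1%:R * cabs (a m.+1) *
        (rho p ^+ m./2 * logw2 p))))%:E); last first.
      rewrite EFinM lee_wpmul2l ?lee_fin ?mulr_ge0// -sumEFin.
      by apply: nneseries_lim_ge => m _ _; rewrite lee_fin majorant_term_ge0.
    rewrite lee_fin mulrAC mulrC; apply: ler_pM; rewrite ?mulr_ge0 ?cabs_ge0//.
      apply: (le_trans (ler_cabs_sum _ _ _)).
      apply: (@le_trans _ _ (M * \sum_(0 <= n < N) (n%:R + 1) ^+ 2 * cabs z ^+ n)); last first.
        by rewrite ler_wpM2l.
      rewrite mulr_sumr; apply: ler_sum => k _.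
      rewrite /be !cabsM cabs_nat !cabsX (_ : cabs (p.1 -i* p.2) = cabs (p.1 +i* p.2)); last first.
        by rewrite -[in RHS]cabs_conj.
      have z0 : 0 <= cabs z ^+ k by rewrite exprn_ge0 ?cabs_ge0.
      rewrite natr1 [leLHS](_ : _ = cabs (c k.+1) * cabs (p.1 +i* p.2) ^+ k *
         (k.+1%:R * cabs z ^+ k)); last by ring.
      rewrite [leRHS](_ : _ = M * k.+1%:R * (k.+1%:R * cabs z ^+ k)); last by ring.
      apply: ler_wpM2r; first by rewrite mulr_ge0.
      apply: ler_pM; [exact: cabs_ge0|exact: exprn_ge0 (cabs_ge0 _)|exact: bM|].
      rewrite (@le_trans _ _ 1)//; last by rewrite ler1n.
      by have /andP[w0 w1] := w01; exact: exprn_ile1.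
    rewrite mulrC; apply: (@le_trans _ _ (logw2 p * \sum_(0 <= m < N) cabs (al m * (p.1 +i* p.2) ^+ m))).
      by rewrite ler_wpM2l// ler_cabs_sum.
    rewrite mulr_sumr; apply: ler_sum => m _.
    rewrite /al !cabsM cabs_nat cabsX mulrC -!mulrA ler_wpM2l// ler_wpM2l ?cabs_ge0//.
    rewrite ler_wpM2r// (le_trans (expr_le_half _ w01))//.
    by rewrite cabs_rho.
have -> : disc_integral (fun w => cderiv f w * cderiv g (z * conjc w) * (logw w)%:C) =
    (pi^-1)%:C * v by apply: disc_integral_has; exact: hv.
have -> : f 0 = a 0%N.
  apply: (@cvgC_unique _ (fun n => series (fun m => a m * 0 ^+ m : C^o) n.+1)).
    by apply/ccvg_shiftS; apply: fa; rewrite inDE cabs0.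
  apply: ccvg_ext (@ccvg_cst _ (a 0%N)) => n.
  rewrite /series /= big_nat_recl// expr0 mulr1 big1 ?addr0// => i _.
  by rewrite expr0n mulr0.
(* Derivatives forget the constant term, so the partial sums are shifted by one and [c 0 * a 0] is
   split off. *)
apply/ccvg_shiftS.
have := ccvgMl (c := z * (pi^-1)%:C) cv; rewrite -mulrA => cv'.
have := ccvgB cv' (@ccvg_cst _ (- (c 0%N * a 0%N))); rewrite opprK addrC.
apply: ccvg_ext => n; rewrite addrC /series /= big_nat_recl// expr0 mulr1.
congr (_ + _); rewrite mulr_sumr; apply: eq_bigr => m _.
have e : (pi^-1)%:C * (pi / m.+1%:R ^+ 2)%:C = (m.+1%:R ^+ 2)^-1 :> C.
  rewrite -rmorphM mulrA mulVf ?gt_eqF ?pi_gt0// mul1r.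
  by rewrite /= fmorphV /= rmorphXn /= rmorph_nat.
transitivity (z * (al m * be m) * ((pi^-1)%:C * (pi / m.+1%:R ^+ 2)%:C)); first by ring.
have m0 : (m.+1%:R : C) != 0 by rewrite pnatr_eq0.
by rewrite e /al /be (exprS z); field.
Qed.

End Duality.

(** * Distributions with prescribed Fourier coefficients *)

Section Distribution.
Variable R : realType.
Local Notation C := R[i].
Local Notation leb := (@lebesgue_measure R).

Definition period_mean (f : R -> R) : R :=
  (2 * pi)^-1 * \int[leb]_(t in `[0, 2 * pi]) f t.

Let tp0 : 0 < 2 * pi :> R.
Proof. by rewrite mulr_gt0// pi_gt0. Qed.

Lemma integral_period_cst (c : R) : \int[leb]_(t in `[0, (2 * pi : R)]) c = c * (2 * pi).
Proof.
rewrite Rintegral_cst//; congr (_ * _).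
have h : fine (leb `[0, (2 * pi : R)]) = 2 * pi.
  by rewrite lebesgue_measure_itv/= lte_fin tp0/= subr0.
exact: h.
Qed.

Lemma continuous_period_integrable (f : R -> R) : continuous f ->
  leb.-integrable `[0, 2 * pi] (EFin \o f).
Proof.
move=> cf; apply: continuous_compact_integrable; first exact: segment_compact.
exact: continuous_subspaceT.
Qed.

Lemma period_mean_linear (a b : R) f g : continuous f -> continuous g ->
  period_mean (fun t => a * f t + b * g t) = a * period_mean f + b * period_mean g.
Proof.
move=> cf cg; have c1 : continuous (fun t => a * f t).
  by move=> t; apply: cvgMl_tmp; exact: cf.
have c2 : continuous (fun t => b * g t).
  by move=> t; apply: cvgMl_tmp; exact: cg.
rewrite /period_mean RintegralD//; [|exact: continuous_period_integrable..].
rewrite !RintegralZl//; [by ring|exact: continuous_period_integrable..].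
Qed.

Lemma period_mean_derive (F f : R -> R) : (forall x : R, is_derive x 1 F (f x)) ->
  continuous f -> F (2 * pi) = F 0 -> period_mean f = 0.
Proof.
by move=> dF cf e; rewrite /period_mean /Rintegral (FTC_derive _ dF)// e subrr /= mulr0.
Qed.

Lemma period_mean_cst (c : R) : period_mean (fun=> c) = c.
Proof.
by rewrite /period_mean integral_period_cst mulrCA mulVf ?mulr1// gt_eqF.
Qed.

Lemma period_mean_le (B : R) f : continuous f ->
  (forall t, 0 <= t <= 2 * pi -> `|f t| <= B) -> `|period_mean f| <= B.
Proof.
move=> cf fB; rewrite /period_mean normrM ger0_norm ?invr_ge0 ?(ltW tp0)//.
have intf := continuous_period_integrable cf.
rewrite ler_pdivrMl// (le_trans (le_normr_Rintegral _ intf))//.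
have <- : (\int[leb]_(t in `[0, (2 * pi : R)]) B : R) = 2 * pi * B.
  by rewrite integral_period_cst mulrC.
apply: le_Rintegral => //.
- exact: integrable_norm.
- by apply: continuous_period_integrable => t; exact: cvg_cst.
Qed.

Lemma smooth_derive (phi : R -> R) k (x : R) : smooth_periodic phi ->
  is_derive x 1 (derive1n k phi) (derive1n k.+1 phi x).
Proof. by move=> [dphi _]; apply: DeriveDef; [exact: dphi|rewrite /= derive1E]. Qed.

Lemma smooth_continuous (phi : R -> R) k : smooth_periodic phi ->
  continuous (derive1n k phi).
Proof.
move=> [dphi _] x.
by apply: differentiable_continuous; apply/derivable1_diffP; exact: dphi.
Qed.

Lemma smooth_derive_periodic (phi : R -> R) x : smooth_periodic phi ->
  derive1n 1 phi (x + 2 * pi) = derive1n 1 phi x.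
Proof.
move=> [_ pphi]; rewrite /= /derive1.
rewrite (_ : (fun h => _) = (fun h => h^-1 *: (phi (h + x) - phi x)))//.
by apply/funext => h; rewrite addrA !pphi.
Qed.

(* [t] and [s] range over the pairs [(cos (n x), sin (n x))] and [(sin (n x), - cos (n x))];
   [phi s / n + phi' t / n ^ 2] is a primitive of [phi t + phi'' t / n ^ 2]. *)
Lemma period_mean_parts (phi t s : R -> R) (n : R) : n != 0 ->
  smooth_periodic phi -> (forall x : R, is_derive x 1 t (- n * s x)) ->
  (forall x : R, is_derive x 1 s (n * t x)) -> t (2 * pi) = t 0 -> s (2 * pi) = s 0 ->
  period_mean (fun x => phi x * t x) =
  - (n ^+ 2)^-1 * period_mean (fun x => derive1n 2 phi x * t x).
Proof.
move=> n0 sphi dt ds t2 s2.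
have c0 := smooth_continuous (k := 0) sphi; have c2 := smooth_continuous (k := 2) sphi.
have ct : continuous t.
  move=> x; apply: differentiable_continuous; apply/derivable1_diffP.
  by have [] := dt x.
have c0t : continuous (fun x => phi x * t x) by move=> x; apply: cvgM; [exact: c0|exact: ct].
have c2t : continuous (fun x => derive1n 2 phi x * t x).
  by move=> x; apply: cvgM; [exact: c2|exact: ct].
have dF (x : R) : is_derive x 1 (fun x => phi x * s x * n^-1 + derive1n 1 phi x * t x * (n ^+ 2)^-1)
    (1 * (phi x * t x) + (n ^+ 2)^-1 * (derive1n 2 phi x * t x)).
  have d0 := smooth_derive 0 x sphi; have d1 := smooth_derive 1 x sphi.
  have h1 := is_deriveM (is_deriveM d0 (ds x)) (is_derive_cst n^-1 x (1 : R)).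
  have h2 := is_deriveM (is_deriveM d1 (dt x)) (is_derive_cst (n ^+ 2)^-1 x (1 : R)).
  apply: (is_derive_eq (is_deriveD h1 h2)).
  rewrite /GRing.scale /= /cst /= !mulr0 !add0r.
  by move: (phi x) (phi^`() x) (phi^`()^`() x) (t x) (s x) => *; field.
have := period_mean_derive dF _ _; rewrite period_mean_linear// => h.
rewrite mul1r in h; apply/eqP; rewrite mulNr -addr_eq0; apply/eqP; apply: h.
- by move=> x; apply: cvgD; apply: cvgMl_tmp; [exact: c0t|exact: c2t].
- have := smooth_derive_periodic 0 sphi; have [_ /(_ 0)] := sphi.
  by rewrite !add0r => -> ->; rewrite t2 s2.
Qed.

Lemma cosin_2pi n : cos (n%:R * (2 * pi)) = 1 :> R /\ sin (n%:R * (2 * pi)) = 0 :> R.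
Proof.
elim: n => [|n [c s]]; first by rewrite mul0r cos0 sin0.
have e : 2 * pi = pi *+ 2 :> R by rewrite mulr_natl.
rewrite -natr1 mulrDl mul1r cosD sinD c s e cos2pi sin2pi.
by split; ring.
Qed.

Lemma is_derive_cosM (n x : R) : is_derive x 1 (fun x => cos (n * x)) (- n * sin (n * x)).
Proof.
have h := @is_derive1_comp R cos ( *%R n) x _ _ (is_derive_cos (n * x))
  (is_deriveZ n (is_derive_id x (1 : R))).
by apply: (is_derive_eq h); rewrite /GRing.scale /=; ring.
Qed.

Lemma is_derive_sinM (n x : R) : is_derive x 1 (fun x => sin (n * x)) (n * cos (n * x)).
Proof.
have h := @is_derive1_comp R sin ( *%R n) x _ _ (is_derive_sin (n * x))
  (is_deriveZ n (is_derive_id x (1 : R))).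
by apply: (is_derive_eq h); rewrite /GRing.scale /=; ring.
Qed.

Lemma continuous_cosM (n : R) : continuous (fun x : R => cos (n * x)).
Proof.
move=> x; apply: differentiable_continuous; apply/derivable1_diffP.
by have [] := is_derive_cosM n x.
Qed.

Lemma continuous_sinM (n : R) : continuous (fun x : R => sin (n * x)).
Proof.
move=> x; apply: differentiable_continuous; apply/derivable1_diffP.
by have [] := is_derive_sinM n x.
Qed.

(** This dominates [1 / n ^ 2] for [n >= 1] and also [1] at [n = 0], so one formula covers all
    frequencies. *)
Definition decay (n : nat) : R := 4 * (n.+1%:R ^+ 2)^-1.

(** Frequency [0] is bounded trivially by [B]; the others gain [1 / n ^ 2] from two integrations by
    parts, in [period_mean_parts]. *)
Lemma period_mean_decay (phi t s : R -> R) (n : nat) (B : R) :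
  smooth_periodic phi -> (forall x : R, is_derive x 1 t (- n%:R * s x)) ->
  (forall x : R, is_derive x 1 s (n%:R * t x)) -> t (2 * pi) = t 0 -> s (2 * pi) = s 0 ->
  (forall x, `|t x| <= 1) ->
  (forall x, 0 <= x <= 2 * pi -> `|phi x| <= B) ->
  (forall x, 0 <= x <= 2 * pi -> `|derive1n 2 phi x| <= B) ->
  `|period_mean (fun x => phi x * t x)| <= B * decay n.
Proof.
move=> sphi dt ds t2 s2 t1 B0 B2.
have ct : continuous t.
  move=> x; apply: differentiable_continuous; apply/derivable1_diffP.
  by have [] := dt x.
have Bge0 : 0 <= B by apply: le_trans (B0 0 _) => //; rewrite lexx ltW.
have le1 (psi : R -> R) : continuous psi -> (forall x, 0 <= x <= 2 * pi -> `|psi x| <= B) ->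
    `|period_mean (fun x => psi x * t x)| <= B.
  move=> cpsi hpsi; apply: period_mean_le.
    by move=> x; apply: cvgM; [exact: cpsi|exact: ct].
  by move=> x xI; rewrite normrM -[B]mulr1 ler_pM// hpsi.
case: n dt ds => [|n] dt ds.
  rewrite (le_trans (le1 _ (smooth_continuous (k := 0) sphi) B0))// ler_peMr// /decay expr1n invr1; lra.
have n0 : n.+1%:R != 0 :> R by rewrite pnatr_eq0.
rewrite (period_mean_parts n0 sphi dt ds t2 s2) normrM mulrC ler_pM//.
  exact: le1 (smooth_continuous (k := 2) sphi) B2.
rewrite normrN ger0_norm ?invr_ge0 ?sqr_ge0// /decay.
have np : 0 < n.+1%:R :> R by rewrite ltr0n.
have np2 : 0 < n.+2%:R :> R by rewrite ltr0n.
rewrite -[leLHS]mul1r ler_pdivrMr ?exprn_gt0// mulrAC ler_pdivlMr ?exprn_gt0//.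
have h1 : (1 : R) <= n.+1%:R by rewrite ler1n.
by rewrite -[n.+2%:R]natr1; nra.
Qed.

Definition cos_coef (phi : R -> R) n := period_mean (fun x => phi x * cos (n%:R * x)).
Definition sin_coef (phi : R -> R) n := period_mean (fun x => phi x * sin (n%:R * x)).

Lemma coef_decay (phi : R -> R) (n : nat) (B : R) : smooth_periodic phi ->
  (forall x, 0 <= x <= 2 * pi -> `|phi x| <= B) ->
  (forall x, 0 <= x <= 2 * pi -> `|derive1n 2 phi x| <= B) ->
  `|cos_coef phi n| <= B * decay n /\ `|sin_coef phi n| <= B * decay n.
Proof.
move=> sphi B0 B2; have [c2 s2] := cosin_2pi n.
split.
  apply: (@period_mean_decay _ _ (fun x => sin (n%:R * x))) => //.
  - by move=> x; exact: is_derive_cosM.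
  - by move=> x; exact: is_derive_sinM.
  - by rewrite mulr0 cos0.
  - by rewrite mulr0 sin0.
  - by move=> x; exact: cos_max.
apply: (@period_mean_decay _ _ (fun x => - cos (n%:R * x))) => //.
- by move=> x; apply: (is_derive_eq (is_derive_sinM n%:R x)); ring.
- by move=> x; apply: (is_derive_eq (is_deriveN (is_derive_cosM n%:R x))); ring.
- by rewrite mulr0 sin0.
- by rewrite mulr0 cos0 c2.
- by move=> x; exact: sin_max.
Qed.

Lemma coef_linear (a b : R) (phi psi : R -> R) n :
  smooth_periodic phi -> smooth_periodic psi ->
  cos_coef (fun t => a * phi t + b * psi t) n = a * cos_coef phi n + b * cos_coef psi n /\
  sin_coef (fun t => a * phi t + b * psi t) n = a * sin_coef phi n + b * sin_coef psi n.
Proof.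
move=> sphi spsi.
have c1 : continuous phi := smooth_continuous (k := 0) sphi.
have c2 : continuous psi := smooth_continuous (k := 0) spsi.
split; rewrite -period_mean_linear; try (by congr period_mean; apply/funext => x; ring);
  move=> x; apply: cvgM; by [exact: c1|exact: c2|exact: continuous_cosM|exact: continuous_sinM].
Qed.

Lemma smooth_bounded (phi : R -> R) : smooth_periodic phi -> exists B,
  (forall x, 0 <= x <= 2 * pi -> `|phi x| <= B) /\
  (forall x, 0 <= x <= 2 * pi -> `|derive1n 2 phi x| <= B).
Proof.
move=> sphi; have bnd k : exists B, forall x, 0 <= x <= 2 * pi -> `|derive1n k phi x| <= B.
  have cn : {within `[0, 2 * pi], continuous (fun x => `|derive1n k phi x|)}.
    apply: continuous_subspaceT => x; apply: continuous_comp; last exact: norm_continuous.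
    exact: smooth_continuous.
  have [c _ hc] := EVT_max (ltW tp0) cn.
  by exists `|derive1n k phi c| => x xI; apply: hc; rewrite in_itv.
have [B0 h0] := bnd 0%N; have [B2 h2] := bnd 2%N.
exists (Num.max B0 B2); split=> x xI; rewrite le_max; first by rewrite (h0 _ xI).
by rewrite (h2 _ xI) orbT.
Qed.

Lemma decay_cvg : cvgn (series decay).
Proof.
apply: is_cvg_series_mull; apply: (@cvg_series_bounded_sum _ _ 2).
  by move=> n; rewrite invr_ge0 sqr_ge0.
exact: sum_inv_sqr_le.
Qed.

End Distribution.

(** * The distribution attached to a bounded sequence *)

Section DistributionOf.
Variable R : realType.
Local Notation C := R[i].

(** The second factor is the mean of [phi] against [e ^ (i n t)], so that [dist_of c] stands for the
    distribution [sum_(n >= 0) c n e ^ (i n t)]. *)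
Definition dist_term (c : nat -> C) (phi : R -> R) (n : nat) : C :=
  c n * (cos_coef phi n +i* sin_coef phi n).

Definition dist_of (c : nat -> C) (phi : R -> R) : C := csum (dist_term c phi).

Lemma dist_term_le M (c : nat -> C) phi B n : bounded_coef M c -> smooth_periodic phi ->
  (forall x, 0 <= x <= 2 * pi -> `|phi x| <= B) ->
  (forall x, 0 <= x <= 2 * pi -> `|derive1n 2 phi x| <= B) ->
  cabs (dist_term c phi n) <= 2 * M * B * decay R n.
Proof.
move=> bM sphi B0 B2; have [h1 h2] := coef_decay n sphi B0 B2.
rewrite /dist_term cabsM.
rewrite [leRHS](_ : _ = M * (B * decay R n + B * decay R n)); last by ring.
apply: ler_pM; rewrite ?cabs_ge0 ?bM//.
by rewrite (le_trans (cabs_le_ReIm _))//= lerD.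
Qed.

Lemma cvg_dist_of M (c : nat -> C) phi : bounded_coef M c -> smooth_periodic phi ->
  series (dist_term c phi : nat -> C^o) @ \oo --> (dist_of c phi : C^o).
Proof.
move=> bM sphi; have [B [B0 B2]] := smooth_bounded sphi.
apply: (@cvg_csum _ _ (fun n => 2 * M * B * decay R n)) => [n|].
  exact: dist_term_le.
by apply: (@is_cvg_series_mull R (2 * M * B) (@decay R)); exact: decay_cvg.
Qed.

Lemma periodic_distribution_dist_of M (c : nat -> C) : bounded_coef M c ->
  periodic_distribution (dist_of c).
Proof.
move=> bM; split=> [a b phi psi sphi spsi|].
  have sab : smooth_periodic (fun t => a * phi t + b * psi t).
    have dk k : derive1n k (fun t => a * phi t + b * psi t) =
        (fun t => a * derive1n k phi t + b * derive1n k psi t).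
      elim: k => [//|k IH]; rewrite /= -/(derive1n k _) IH; apply/funext => x.
      have h1 := is_deriveZ a (smooth_derive k x sphi).
      have h2 := is_deriveZ b (smooth_derive k x spsi).
      by rewrite derive1E; have [_ ->] := is_deriveD h1 h2.
    split=> [k x|x]; last by have [_ ->] := sphi; have [_ ->] := spsi.
    rewrite dk; have h1 := is_deriveZ a (smooth_derive k x sphi).
    have h2 := is_deriveZ b (smooth_derive k x spsi).
    by have [] := is_deriveD h1 h2.
  have c1 := ccvgMl (c := a%:C) (cvg_dist_of bM sphi).
  have c2 := ccvgMl (c := - b%:C) (cvg_dist_of bM spsi).
  have c3 := ccvgB c1 c2.
  apply: (cvgC_unique (cvg_dist_of bM sab)).
  rewrite mulNr opprK in c3; apply: ccvg_ext c3 => n.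
  rewrite mulNr opprK /series /= !mulr_sumr -big_split; apply: eq_bigr => i _ /=.
  have [e1 e2] := coef_linear a b i sphi spsi; rewrite /dist_term e1 e2.
  rewrite [X in _ = c i * X](_ : _ = a%:C * (cos_coef phi i +i* sin_coef phi i) +
     b%:C * (cos_coef psi i +i* sin_coef psi i)).
    by move: (_ +i* _) (_ +i* _) a%:C b%:C (c i) => z w x y t; ring.
  by apply/eqP; rewrite eq_complex /=; apply/andP; split; apply/eqP; ring.
(* The order is [2] because the coefficient bound involves [phi] and its second derivative; the
   constant is the sum of the majorants with [B] taken out. *)
exists (2 * M * limn (series (@decay R))), 2%N => phi sphi B hB.
have h : (forall n, cabs (dist_term c phi n) <= 2 * M * B * decay R n).
  by move=> n; apply: dist_term_le => // x _; [exact: (hB 0%N)|exact: hB].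
apply: le_trans (cvg_series_le (cvg_dist_of bM sphi) h _) _.
  by apply: (@is_cvg_series_mull R (2 * M * B) (@decay R)); exact: decay_cvg.
by rewrite lim_series_mull; [rewrite mulrAC|exact: decay_cvg].
Qed.

Lemma csum_single (a : nat -> C) m : (forall n, n != m -> a n = 0) -> csum a = a m.
Proof.
move=> a0; have h : cvgn (series (fun n => cabs (a n))).
  apply: (@cvg_series_bounded_sum _ _ (cabs (a m))) => [n|N]; first exact: cabs_ge0.
  have [mN|Nm] := ltnP m N.
    rewrite (bigD1_seq m) ?iota_uniq ?mem_index_iota//= big1 ?addr0// => n /a0 ->.
    exact: cabs0.
  rewrite big_nat_cond big1 ?cabs_ge0// => n /andP[/andP[_ nN] _].
  by rewrite a0 ?cabs0// ltn_eqF// (leq_trans nN).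
apply: (cvgC_unique (cvg_csum (fun n => lexx (cabs (a n))) h)).
apply/ccvgP/cvgrPdist_lt => e e0; near=> N.
rewrite /series /= (bigD1_seq m) ?iota_uniq ?mem_index_iota//=; last by near: N; exists m.+1.
by rewrite big1 ?addr0 ?subrr ?cabs0 ?subr0 ?normr0.
Unshelve. all: by end_near. Qed.

Lemma period_mean_cosM (k : R) : sin (k * (2 * pi)) = 0 ->
  period_mean (fun t => cos (k * t)) = (k == 0)%:R.
Proof.
have [->|k0] := eqVneq k 0.
  by move=> _; under eq_fun do rewrite mul0r cos0; rewrite period_mean_cst.
move=> s0; apply: (@period_mean_derive _ (fun t => k^-1 * sin (k * t))).
- by move=> x; apply: (is_derive_eq (is_deriveZ k^-1 (is_derive_sinM k x)));
    rewrite /GRing.scale /= mulKf.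
- exact: continuous_cosM.
- by rewrite s0 !mulr0 sin0 mulr0.
Qed.

Lemma period_mean_sinM (k : R) : cos (k * (2 * pi)) = 1 ->
  period_mean (fun t => sin (k * t)) = 0.
Proof.
have [->|k0] := eqVneq k 0.
  by move=> _; under eq_fun do rewrite mul0r sin0; rewrite period_mean_cst.
move=> s0; apply: (@period_mean_derive _ (fun t => - k^-1 * cos (k * t))).
- move=> x; apply: (is_derive_eq (is_deriveZ (- k^-1) (is_derive_cosM k x))).
  by transitivity (- k^-1 * (- k * sin (k * x))) => //; field.
- exact: continuous_sinM.
- by rewrite s0 mulr0 cos0.
Qed.

(** Product-to-sum formulas. The condition [m + n = 0] is met only for [m = n = 0], where the cosine
    is constant and the sine vanishes. *)
Lemma trig_coefs m n :
  [/\ cos_coef (fun t : R => cos (m%:R * t)) n =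
        2^-1 * (m%:R + n%:R == 0 :> R)%:R + 2^-1 * (m%:R - n%:R == 0 :> R)%:R,
      sin_coef (fun t : R => cos (m%:R * t)) n = 0,
      cos_coef (fun t : R => sin (m%:R * t)) n = 0 &
      sin_coef (fun t : R => sin (m%:R * t)) n =
        2^-1 * (m%:R - n%:R == 0 :> R)%:R - 2^-1 * (m%:R + n%:R == 0 :> R)%:R].
Proof.
have [cm sm] := cosin_2pi R m; have [cn sn] := cosin_2pi R n.
have sp : sin ((m%:R + n%:R) * (2 * pi)) = 0 :> R by rewrite mulrDl sinD cm sm cn sn; ring.
have cp : cos ((m%:R + n%:R) * (2 * pi)) = 1 :> R by rewrite mulrDl cosD cm sm cn sn; ring.
have sd : sin ((m%:R - n%:R) * (2 * pi)) = 0 :> R by rewrite mulrBl sinB cm sm cn sn; ring.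
have cd : cos ((m%:R - n%:R) * (2 * pi)) = 1 :> R by rewrite mulrBl cosB cm sm cn sn; ring.
rewrite -(period_mean_cosM sp) -(period_mean_cosM sd).
have zp := period_mean_sinM cp; have zd := period_mean_sinM cd.
have cc := continuous_cosM; have cs := continuous_sinM.
split; rewrite /cos_coef /sin_coef.
- rewrite -period_mean_linear//; congr period_mean; apply/funext => t.
  by rewrite mulrDl mulrBl cosD cosB; field.
- rewrite [RHS](_ : _ = 2^-1 * 0 + (- 2^-1) * 0); last by ring.
  rewrite -{1}zp -zd -period_mean_linear//; congr period_mean; apply/funext => t.
  by rewrite mulrDl mulrBl sinD sinB; field.
- rewrite [RHS](_ : _ = 2^-1 * 0 + 2^-1 * 0); last by ring.
  rewrite -{1}zp -zd -period_mean_linear//; congr period_mean; apply/funext => t.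
  by rewrite mulrDl mulrBl sinD sinB; field.
- rewrite -mulNr -period_mean_linear//; congr period_mean; apply/funext => t.
  by rewrite mulrBl mulrDl cosB cosD; field.
Qed.

(** On the diagonal the cosine contributes [(1 + d) / 2] and the sine [(1 - d) / 2], where [d] is
    [1] for [m = 0] and [0] otherwise; the total is [1] in both cases. *)
Lemma fourier_coef_dist_of (c : nat -> C) m : fourier_coef (dist_of c) m = c m.
Proof.
have off n : n != m -> (m%:R + n%:R == 0 :> R) = false /\ (m%:R - n%:R == 0 :> R) = false.
  move=> nm; rewrite -natrD pnatr_eq0 subr_eq0 eqr_nat addn_eq0 eq_sym.
  by split; [case: m n nm => [|m] [|n]//|apply/negbTE; rewrite eq_sym].
rewrite /fourier_coef /dist_of (csum_single (m := m)); last first.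
  move=> n /off[h1 h2]; rewrite /dist_term; have [-> -> _ _] := trig_coefs m n.
  by rewrite h1 h2 !mulr0 addr0 (_ : 0 +i* 0 = 0) ?mulr0.
rewrite (csum_single (m := m)); last first.
  move=> n /off[h1 h2]; rewrite /dist_term; have [_ _ -> ->] := trig_coefs m n.
  by rewrite h1 h2 !mulr0 subr0 (_ : 0 +i* 0 = 0) ?mulr0.
rewrite /dist_term; have [-> -> -> ->] := trig_coefs m m.
rewrite subrr eqxx mulr1; case: (_ == 0); case: (c m) => x y;
  by apply/eqP; rewrite eq_complex /=; apply/andP; split; apply/eqP; field.
Qed.

End DistributionOf.

(** * Coefficients of functions in the Hardy space *)

Section HardySpace.
Variable R : realType.
Local Notation C := R[i].
Implicit Types (a b c : nat -> C) (f g : C -> C).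

Definition H2fun a : C -> C := fun z => if inD z then csum (fun n => a n * z ^+ n) else 0.

Lemma H2coef_H2fun a : sqsummable a -> H2coef (H2fun a) a.
Proof.
move=> sa; have [A bA] := sqsummable_bounded_coef sa; split=> //; split=> z zD.
  by rewrite /H2fun zD; exact: pseries_cvg bA zD.
by rewrite /H2fun (negbTE zD).
Qed.

Lemma H2coef_inj f a b : H2coef f a -> H2coef f b -> a = b.
Proof.
move=> [sa [fa _]] [sb [fb _]].
have [A bA] := sqsummable_bounded_coef sa; have [B bB] := sqsummable_bounded_coef sb.
by apply: (pseries_unique bA bB) => z zD; exists (f z); split; [exact: fa|exact: fb].
Qed.

Lemma H2coef_fun f g a : H2coef f a -> H2coef g a -> f = g.
Proof.
move=> [_ [fa f0]] [_ [ga g0]]; apply/funext => z.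
have [zD|zD] := boolP (inD z); last by rewrite f0 ?g0.
exact: cvgC_unique (fa z zD) (ga z zD).
Qed.

Lemma sqsummable_le a b (K : R) : sqsummable a ->
  (forall n, csqn (b n) <= K * csqn (a n)) -> sqsummable b.
Proof.
move=> sa ba; have cK := is_cvg_series_mull (k := K) sa.
apply: (series_le_cvg _ _ ba cK) => n; first exact: csqn_ge0.
exact: le_trans (csqn_ge0 _) (ba n).
Qed.

Lemma csqnM (z w : C) : csqn (z * w) = csqn z * csqn w.
Proof. by rewrite !csqnE cabsM exprMn. Qed.

Lemma H2coef_lin (k : C) f g a b : H2coef f a -> H2coef g b ->
  H2coef (fun z => k * f z + g z) (fun n => k * a n + b n).
Proof.
move=> [sa [fa f0]] [sb [gb g0]]; split; last split.
(* The comparison is [|x + y| ^ 2 <= 2 |x| ^ 2 + 2 |y| ^ 2]. *)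
- have cs : cvgn (series (fun n => 2 * (csqn k * csqn (a n)) + 2 * csqn (b n))).
    rewrite [X in cvgn X](_ : _ = (fun n => series (fun n => 2 * csqn k * csqn (a n)) n +
       series (fun n => 2 * csqn (b n)) n)).
      by apply: is_cvgD; exact: is_cvg_series_mull.
    by apply/funext => n; rewrite /series /= -big_split; apply: eq_bigr => i _ /=; ring.
  apply: (series_le_cvg _ _ _ cs) => n; first exact: csqn_ge0.
    by rewrite addr_ge0// !mulr_ge0// csqn_ge0.
  rewrite -csqnM; move: (k * a n) (b n) => [x y] [x' y']; rewrite /csqn /=.
  by have := sqr_ge0 (x - x'); have := sqr_ge0 (y - y'); nra.
- move=> z zD; have h1 := ccvgMl (c := k) (fa z zD).
  have h2 := ccvgMl (c := -1) (gb z zD).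
  have := ccvgB h1 h2; rewrite mulN1r opprK; apply: ccvg_ext => n.
  rewrite mulN1r opprK /series /= mulr_sumr -big_split; apply: eq_bigr => i _ /=; ring.
- by move=> z zD; rewrite f0// g0// mulr0 addr0.
Qed.

Lemma H2coef_rot (lam : C) f a : csqn lam = 1 -> H2coef f a ->
  H2coef (Vrot lam f) (fun n => lam ^+ n * a n).
Proof.
move=> l1 [sa [fa f0]].
have lD z : inD (lam * z) = inD z by rewrite /inD csqnM l1 mul1r.
split; last split.
- have ln n : csqn (lam ^+ n) = 1.
    by elim: n => [|n IH]; rewrite ?exprS ?csqnM ?l1 ?IH ?mulr1// csqnE cabs1 expr1n.
  rewrite /sqsummable (_ : (fun m => _) = (fun m => csqn (a m)))//.
  by apply/funext => n; rewrite csqnM ln mul1r.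
- move=> z zD; rewrite /Vrot; have := fa (lam * z); rewrite lD => /(_ zD).
  apply: ccvg_ext => n; apply: eq_bigr => i _; rewrite exprMn; ring.
- by move=> z zD; rewrite /Vrot f0// lD.
Qed.

Lemma le_l2norm a b (M : R) : 0 <= M -> sqsummable a ->
  (forall n, cabs (b n) <= M * cabs (a n)) -> l2norm b <= M * l2norm a.
Proof.
move=> M0 sa ba.
have le n : csqn (b n) <= M ^+ 2 * csqn (a n).
  by rewrite !csqnE -exprMn lerXn2r ?nnegrE ?cabs_ge0 ?mulr_ge0 ?cabs_ge0.
rewrite /l2norm -[M in leRHS]ger0_norm// -sqrtr_sqr -sqrtrM ?sqr_ge0// ler_wsqrtr//.
rewrite -lim_series_mull//; apply: lim_series_le => //; first exact: sqsummable_le le.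
exact: is_cvg_series_mull.
Qed.

Lemma coef_le_l2norm a n : sqsummable a -> cabs (a n) <= l2norm a.
Proof.
move=> sa; rewrite /l2norm /cabs ler_wsqrtr//.
apply: le_trans (nondecreasing_cvgn_le _ sa n.+1); last first.
  by apply: nondecreasing_series => k _ _; exact: csqn_ge0.
rewrite /series /= big_nat_recr//= lerDr; apply: sumr_ge0 => i _; exact: csqn_ge0.
Qed.

Definition truncate N a : nat -> C := fun n => if (n < N)%N then a n else 0.
Definition tail N a : nat -> C := fun n => if (n < N)%N then 0 else a n.

Lemma csqn0 : csqn (0 : C) = 0.
Proof. by rewrite csqnE cabs0 expr0n. Qed.

Lemma sqsummable_truncate N a : sqsummable a -> sqsummable (truncate N a).
Proof.
move=> sa; apply: (sqsummable_le (K := 1) sa) => n; rewrite mul1r /truncate.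
by case: ifP => // _; rewrite csqn0 csqn_ge0.
Qed.

Lemma sqsummable_tail N a : sqsummable a -> sqsummable (tail N a).
Proof.
move=> sa; apply: (sqsummable_le (K := 1) sa) => n; rewrite mul1r /tail.
by case: ifP => // _; rewrite csqn0 csqn_ge0.
Qed.

(** This is the density of polynomials in [H^2], expressed on coefficients. *)
Lemma l2norm_tail a (e : R) : sqsummable a -> 0 < e ->
  exists N0, forall N, (N0 <= N)%N -> l2norm (tail N a) <= e.
Proof.
move=> sa e0; have e2 : 0 < e ^+ 2 by rewrite exprn_gt0.
set L := limn (series (fun m => csqn (a m))).
have nd : nondecreasing_seq (series (fun m => csqn (a m))).
  by apply: nondecreasing_series => k _ _; exact: csqn_ge0.
have /cvgrPdist_lt /(_ _ e2) [N0 _ hN0] : series (fun m => csqn (a m)) @ \oo --> L by exact: sa.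
exists N0 => N /hN0 /= hN.
have hL n : series (fun m => csqn (a m)) n <= L by apply: nondecreasing_cvgn_le.
rewrite /l2norm -[e]ger0_norm ?(ltW e0)// -sqrtr_sqr ler_wsqrtr//.
apply: limr_le; first exact: sqsummable_tail.
(* The range is enlarged to [N + n] so that it can be cut at [N]. *)
apply: nearW => n; apply: (@le_trans _ _ (\sum_(0 <= i < N + n) csqn (tail N a i))).
  rewrite [leRHS](@big_cat_nat _ _ _ n)//= ?leq_addl// lerDl.
  by apply: sumr_ge0 => i _; exact: csqn_ge0.
rewrite (@big_cat_nat _ _ _ N)//= ?leq_addr//.
rewrite big_nat_cond big1 ?add0r; last first.
  by move=> i /andP[/andP[_ iN] _]; rewrite /tail iN csqn0.
have := hL (N + n)%N; rewrite /series /= (@big_cat_nat _ _ _ N)//= ?leq_addr// => h.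
rewrite (_ : \sum_(N <= i < N + n) csqn (tail N a i) = \sum_(N <= i < N + n) csqn (a i)); last first.
  by apply: eq_big_nat => i /andP[Ni _]; rewrite /tail ltnNge Ni.
move: hN; rewrite ger0_norm ?subr_ge0 ?hL// /series /=; lra.
Qed.

End HardySpace.

(** * Radial operators are coefficient multipliers *)

Section RadialOperators.
Variable R : realType.
Local Notation C := R[i].
Implicit Types (a b c : nat -> C) (f g : C -> C).
Variable T : (C -> C) -> (C -> C).
Hypothesis TL : H2_linear T.

Lemma exists_unit_separating (d : nat) : (0 < d)%N -> exists lam : C, csqn lam = 1 /\ lam ^+ d = -1.
Proof.
move=> d0; exists (d.-root (-1 : C)); have e : d.-root (-1 : C) ^+ d = -1 by exact: rootCK.
split=> //; rewrite csqnE.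
suff -> : cabs (d.-root (-1 : C)) = 1 by rewrite expr1n.
have : cabs (d.-root (-1 : C)) ^+ d = 1 by rewrite -cabsX e cabsN cabs1.
by move=> /eqP; rewrite (pexpr_eq1 d0) ?cabs_ge0// => /eqP.
Qed.

(** Linearity at [c = 1] gives [T 0 = T 0 + T 0]. *)
Lemma T_zero : T (fun=> 0) = (fun=> 0).
Proof.
have h0 : H2 (fun _ : C => 0 : C).
  exists (fun=> 0); split; last split=> //.
    rewrite /sqsummable (_ : series _ = cst 0); first exact: is_cvg_cst.
    by apply/funext => n; rewrite /series /= big1// => i _; rewrite csqn0.
  move=> z _; apply: ccvg_ext (@ccvg_cst _ (0 : C)) => n.
  by rewrite /series /= big1// => i _; rewrite mul0r.
have [_ /(_ 1 _ _ h0 h0)] := TL.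
rewrite (_ : (fun _ : C => 1 * 0 + 0 : C) = (fun=> 0)); last first.
  by apply/funext => z; rewrite mulr0 addr0.
move=> e; apply/funext => z; have /eqP := congr1 (@^~ z) e.
by rewrite mul1r -subr_eq0 opprD addrA subrr sub0r oppr_eq0 => /eqP.
Qed.

Lemma T_coef f a : H2coef f a -> exists b, H2coef (T f) b.
Proof. by move=> fa; have [+ _] := TL; apply; exists a. Qed.

Definition unit_coef (m : nat) : nat -> C := fun n => (n == m)%:R.

Lemma sum_csqn_unit_le m N : \sum_(0 <= n < N) csqn (unit_coef m n) <= 1.
Proof.
have [mN|Nm] := ltnP m N.
  rewrite (bigD1_seq m) ?iota_uniq ?mem_index_iota//= big1 ?addr0.
    by rewrite /unit_coef eqxx csqnE cabs1 expr1n.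
  by move=> n nm; rewrite /unit_coef (negbTE nm) csqn0.
rewrite big_nat_cond big1// => n /andP[/andP[_ nN] _].
by rewrite /unit_coef ltn_eqF ?csqn0// (leq_trans nN).
Qed.

Lemma sqsummable_unit m : sqsummable (unit_coef m).
Proof.
apply: (@cvg_series_bounded_sum _ _ 1) => [n|N]; first exact: csqn_ge0.
exact: sum_csqn_unit_le.
Qed.

Lemma l2norm_unit m : l2norm (unit_coef m) = 1.
Proof.
apply/eqP; rewrite eq_le; apply/andP; split; last first.
  apply: le_trans (coef_le_l2norm m (@sqsummable_unit m)).
  by rewrite /unit_coef eqxx cabs1.
rewrite -sqrtr1 /l2norm ler_wsqrtr//; apply: limr_le; first exact: sqsummable_unit.
by apply: nearW => N; exact: sum_csqn_unit_le.
Qed.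

(** The monomial [z ^ m], cut off outside the disc. *)
Let e m : C -> C := H2fun (unit_coef m).
Let eH m : H2coef (e m) (unit_coef m) := H2coef_H2fun (@sqsummable_unit m).

Section Radial.
Hypothesis TR : H2_radial T.

Lemma radial_unit_coef m b k : H2coef (T (e m)) b -> k != m -> b k = 0.
Proof.
move=> Tb km.
(* The image of the rotated monomial is computed twice, by radiality on the left and by linearity on
   the right. *)
have key (lam : C) : csqn lam = 1 -> lam ^+ k * b k = lam ^+ m * b k.
  move=> l1; have h := TR l1 (ex_intro _ _ (eH m)).
  have r1 := H2coef_rot l1 Tb; rewrite -h in r1.
  have e0 : H2coef (fun _ : C => 0) (fun=> 0).
    have := H2coef_lin (-1) (eH m) (eH m).
    rewrite (_ : (fun z => _) = fun=> 0); last by apply/funext => z; rewrite mulN1r addNr.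
    by rewrite (_ : (fun n => _) = fun=> 0)//; apply/funext => z; rewrite mulN1r addNr.
  (* Linearity is stated for [c * f + g], so a scalar multiple is written with the summand [0]. *)
  have er : Vrot lam (e m) = (fun z => lam ^+ m * e m z + 0).
    apply: (H2coef_fun (H2coef_rot l1 (eH m))).
    have := H2coef_lin (lam ^+ m) (eH m) e0.
    rewrite (_ : (fun n => lam ^+ m * _ n + 0) = (fun n => lam ^+ n * unit_coef m n))//.
    by apply/funext => n; rewrite addr0 /unit_coef; case: eqP => [->|]//; rewrite !mulr0.
  have [_ lin] := TL; rewrite er lin ?T_zero in r1; [|by exists (unit_coef m)|by exists (fun=> 0)].
  have r2 := H2coef_lin (lam ^+ m) Tb e0.
  by have := congr1 (@^~ k) (H2coef_inj r1 r2); rewrite addr0.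
have sep i d : (0 < d)%N -> (forall lam : C, csqn lam = 1 ->
    lam ^+ (i + d) * b k = lam ^+ i * b k) -> b k = 0.
  move=> d0 h; have [lam [l1 ld]] := exists_unit_separating d0.
  have := h _ l1; rewrite exprD ld mulrN1 mulNr => /eqP.
  rewrite eq_sym -subr_eq0 opprK -mulr2n mulrn_eq0 /= mulf_eq0 expf_eq0 => /orP[|/eqP//].
  by rewrite -cabs_eq0 => /andP[_ /eqP l0]; move: l1 => /eqP; rewrite csqnE l0 expr0n eq_sym oner_eq0.
have [km'|mk|/eqP] := ltngtP k m; last by rewrite (negbTE km).
  apply: (sep k (m - k)%N); first by rewrite subn_gt0.
  by move=> lam l1; rewrite subnKC ?(ltnW km')// key.
apply: (sep m (k - m)%N); first by rewrite subn_gt0.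
by move=> lam l1; rewrite subnKC ?(ltnW mk)// key.
Qed.

Lemma exists_multiplier : exists c, forall m, H2coef (T (e m)) (fun n => c m * unit_coef m n).
Proof.
have h m : exists cm : C, H2coef (T (e m)) (fun n => cm * unit_coef m n).
  have [b hb] := T_coef (eH m); exists (b m).
  rewrite (_ : (fun n => _) = b)//; apply/funext => n; rewrite /unit_coef.
  by have [->|nm] := eqVneq n m; rewrite ?mulr1// mulr0 (radial_unit_coef hb nm).
by have [c hc] := choice h; exists c.
Qed.

Lemma truncate_multiplier c : (forall m, H2coef (T (e m)) (fun n => c m * unit_coef m n)) ->
  forall a N, sqsummable a -> H2coef (T (H2fun (truncate N a))) (truncate N (fun n => c n * a n)).
Proof.
move=> hc a N sa; elim: N => [|N IH].
  have -> : truncate 0 a = (fun=> 0) by apply/funext.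
  have -> : truncate 0 (fun n => c n * a n) = (fun=> 0) by apply/funext.
  have := H2coef_lin (-1) (hc 0%N) (hc 0%N).
  rewrite (_ : (fun n => _) = fun=> 0); last by apply/funext => n; rewrite mulN1r addNr.
  rewrite (_ : (fun z => _) = fun=> 0); last by apply/funext => z; rewrite mulN1r addNr.
  rewrite (_ : H2fun (fun=> 0) = fun=> 0) ?T_zero//.
  apply/funext => z; rewrite /H2fun; case: ifP => // _; rewrite (csum_single (m := 0%N)) ?mul0r//.
  by move=> n _; rewrite mul0r.
have hN := H2coef_H2fun (sqsummable_truncate (N := N) sa).
have -> : H2fun (truncate N.+1 a) = (fun z => a N * e N z + H2fun (truncate N a) z).
  apply: (H2coef_fun (H2coef_H2fun (sqsummable_truncate (N := N.+1) sa))).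
  rewrite (_ : truncate N.+1 a = (fun n => a N * unit_coef N n + truncate N a n)).
    exact: H2coef_lin (eH N) hN.
  apply/funext => n; rewrite /truncate /unit_coef ltnS leq_eqVlt.
  by have [->|] := eqVneq n N; rewrite ?ltnn ?mulr1 ?addr0// mulr0 add0r.
have [_ ->] := TL; [|by exists (unit_coef N)|by exists (truncate N a)].
rewrite (_ : truncate N.+1 _ = (fun n => a N * (c N * unit_coef N n) +
    truncate N (fun n => c n * a n) n)); first exact: H2coef_lin.
apply/funext => n; rewrite /truncate /unit_coef ltnS leq_eqVlt.
have [->|] := eqVneq n N; rewrite ?ltnn ?mulr1 ?addr0; first by rewrite mulrC.
by rewrite /= !mulr0 add0r.
Qed.

Hypothesis TB : H2_bounded T.

(** The norm of the image of [z ^ m] bounds [c m]. For general [f], the [k]-th coefficient of [T f]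
    differs from [c k * a k] by that of the image of a tail of [f], which boundedness makes
    arbitrarily small. *)
Lemma radial_multiplier : exists c, (exists M, bounded_coef M c) /\
  forall f a, H2coef f a -> H2coef (T f) (fun n => c n * a n).
Proof.
have [M hM] := TB; have [c hc] := exists_multiplier.
exists c; split.
  exists M => m; have := hM _ _ _ (eH m) (hc m); rewrite l2norm_unit mulr1.
  apply: le_trans; have [sc _] := hc m.
  by have := coef_le_l2norm m sc; rewrite /unit_coef eqxx mulr1.
move=> f a fa; have [sa _] := fa; have [b hb] := T_coef fa.
suff -> : (fun n => c n * a n) = b by [].
apply/funext => k; apply/eqP; rewrite eq_sym -subr_eq0 -cabs_eq0 eq_le cabs_ge0 andbT.
apply/ler_addgt0Pl => eps eps0; rewrite addr0.
(* The constant [M] carries no sign, so it is replaced by a positive one. *)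
have M1 : 0 < `|M| + 1 by rewrite ltr_wpDl.
have [N0 hN0] := l2norm_tail sa (divr_gt0 eps0 M1).
(* With [k < N] the truncated part of [f] accounts for the coefficient [c k * a k] exactly. *)
pose N := maxn N0 k.+1.
have kN : (k < N)%N by rewrite /N leq_max leqnn orbT.
have hN : l2norm (tail N a) <= eps / (`|M| + 1) by apply: hN0; rewrite leq_maxl.
have h1 := H2coef_H2fun (sqsummable_truncate (N := N) sa).
have h2 := H2coef_H2fun (sqsummable_tail (N := N) sa).
have fE : f = (fun z => 1 * H2fun (truncate N a) z + H2fun (tail N a) z).
  apply: (H2coef_fun fa); have := H2coef_lin 1 h1 h2; congr H2coef; apply/funext => n.
  by rewrite mul1r /truncate /tail; case: ifP; rewrite ?addr0 ?add0r.
have [r hr] := T_coef h2.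
have [_ lin] := TL.
have ht := truncate_multiplier hc N sa.
rewrite fE lin in hb; [|by exists (truncate N a)|by exists (tail N a)].
have -> : b k - c k * a k = r k.
  rewrite (congr1 (@^~ k) (H2coef_inj hb (H2coef_lin 1 ht hr))).
  by rewrite mul1r /truncate kN addrAC subrr add0r.
have [sr _] := hr; apply: (le_trans (coef_le_l2norm k sr)).
apply: (le_trans (hM _ _ _ h2 hr)).
have t0 : 0 <= l2norm (tail N a) by rewrite sqrtr_ge0.
have : (`|M| + 1) * l2norm (tail N a) <= eps by rewrite mulrC -ler_pdivlMr.
have := ler_norm M; nra.
Qed.

End Radial.

Lemma multiplier_bounded_radial M c : bounded_coef M c ->
  (forall f a, H2coef f a -> H2coef (T f) (fun n => c n * a n)) ->
  H2_bounded T /\ H2_radial T.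
Proof.
move=> bM hT; split.
  exists M => f a b fa hb; rewrite (H2coef_inj hb (hT _ _ fa)).
  have [sa _] := fa; apply: le_l2norm => //; first exact: bounded_coef_ge0 bM.
  by move=> n; rewrite cabsM ler_wpM2r ?cabs_ge0.
move=> lam l1 f [a fa]; apply: (H2coef_fun (hT _ _ (H2coef_rot l1 fa))).
have := H2coef_rot l1 (hT _ _ fa).
rewrite (_ : (fun n => lam ^+ n * (c n * a n)) = (fun n => c n * (lam ^+ n * a n)))//.
by apply/funext => n; rewrite mulrCA.
Qed.

End RadialOperators.

(** * The characterisation of bounded radial operators *)

Theorem theorem5p2 (R : realType) (T : (R[i] -> R[i]) -> (R[i] -> R[i])) :
  H2_linear T ->
  (H2_bounded T /\ H2_radial T <->
   exists (u : (R -> R) -> R[i]) (g : R[i] -> R[i]),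
     [/\ periodic_distribution u,
         (exists M : R, forall m : nat, cabs (fourier_coef u m) <= M),
         induces u g &
         forall f, H2 f -> forall z : R[i], inD z ->
           T f z = fourier_coef u 0 * f 0
                   + z * disc_integral
                           (fun w => cderiv f w * cderiv g (z * conjc w)
                                     * (logw w)%:C)]).
Proof.
move=> TL; split=> [[TB TR]|[u [g [_ [M bM] ug Tf]]]].
  have [c [[M bM] hT]] := radial_multiplier TL TR TB.
  have cE : fourier_coef (dist_of c) = c by apply/funext => m; exact: fourier_coef_dist_of.
  exists (dist_of c), (fun z => csum (fun m => c m * z ^+ m)).
  have gc z : inD z -> pseries_to c z (csum (fun m => c m * z ^+ m)) := pseries_cvg bM.
  split; first exact: periodic_distribution_dist_of bM.
  - by exists M; rewrite cE.
  - by move=> z zD; rewrite cE; exact: gc.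
  (* Both [T f z] and the integral formula are limits of the series with coefficients
     [c m * a m]. *)
  move=> f [a fa] z zD; have [sa [fz _]] := fa; have [_ [Tz _]] := hT _ _ fa.
  rewrite cE; apply: cvgC_unique (Tz z zD) _.
  exact: littlewood_paley_pairing sa fz bM gc zD.
apply: (multiplier_bounded_radial (c := fourier_coef u) bM) => f a fa.
have [sa [fz _]] := fa; have [b hb] := T_coef TL fa.
(* The formula expands into the multiplier series at every point of the disc; uniqueness of power
   series, which asks only for bounded coefficients, identifies it with the Taylor series of
   [T f]. *)
suff <- : b = (fun n => fourier_coef u n * a n) by [].
have [sb [Tz _]] := hb.
have [B bB] := sqsummable_bounded_coef sb; have [A bA] := sqsummable_bounded_coef sa.
apply: (pseries_unique (A := B) (B := M * A)) => // [n|z zD].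
  by rewrite cabsM ler_pM ?cabs_ge0// ?bM ?bA.
exists (T f z); split; first exact: Tz.
rewrite Tf//; last by exists a.
exact: littlewood_paley_pairing sa fz bM ug zD.
Qed.
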